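(* Let $A\hookrightarrow(S,O)$ be a reduced plane curve singularity and let $\Lambda(\hat{\mathcal{C}}_A)$ be the lotus of a finite active constellation of crosses $\hat{\mathcal{C}}_A$ adapted to $A$. Denote by $\mathcal{P}$ the set of edges of $\Lambda(\hat{\mathcal{C}}_A)$ which are bases of petals, partially ordered through the order $\preceq$ on the corresponding active points. Perform the following algorithm of computation of weights of the edges in $\mathcal{P}$, in a descending way relative to this partial order: (1) One starts by attaching the weight $1$ to each base edge which corresponds to an inactive point of the underlying constellation. (2) One computes the weight of a lower edge $e$ as the sum of the weights of the higher edges which are incident to the vertex opposite to $e$ in the petal with base $e$. Then each edge gets decorated by the multiplicity of $A$ at the infinitely near point which corresponds to it.
   Context: **Infinitely near points and crosses.** $(S,O)$ is a germ of smooth complex analytic surface. A model is a composition of finitely many blowups of points above $O$. An infinitely near point of $O$ is $O$ or a point of the exceptional divisor of a model, points on two models being identified if the natural bimeromorphic map is a biholomorphism near them; $S^P$ is the minimal model containing $P$, and $E_P$ is the exceptional curve created by blowing up $P$ (also denoting its strict transforms). $P\preceq Q$ means that $Q$ is infinitely near $P$; then there is a morphism $\pi^Q_P:S^Q\to S^P$. A constellation is a set $\mathcal{C}$ of infinitely near points such that $Q\in\mathcal{C}$, $P\preceq Q$ imply $P\in\mathcal{C}$; it is active if one has chosen a subset of active points containing all non-maximal points; the others are inactive. A cross at $P$ is a reduced germ of normal crossings divisor with two branches at $P$. A constellation of crosses $\hat{\mathcal{C}}$ is a constellation $\mathcal{C}$ with a cross $X_P$ on $(S^P,P)$ for each $P\in\mathcal{C}$,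 such that the germ at $Q$ of $(\pi^Q_P)^{-1}(X_P)$ is contained in $X_Q$ whenever $P\preceq Q$. $S_{\mathcal{C}}$ is the model obtained by blowing up all active points, and $X_{\hat{\mathcal{C}}}$ is the total transform on $S_{\mathcal{C}}$ of all the crosses. $\hat{\mathcal{C}}_A$ is adapted to $A$ if its underlying constellation is the set of infinitely near points lying on the strict transforms of $A$ on the models between $S$ and an embedded resolution $\pi$ of $A$ (a model on which the total transform of $A$ is a normal crossings divisor), with the maximal points declared inactive, and $\pi^{-1}(A)\subseteq X_{\hat{\mathcal{C}}_A}$. **Lotus.** The dual segment of a cross is a segment with vertices labeled by its two branches. The lotus $\Lambda(\hat{\mathcal{C}})$ is the simplicial complex built by starting from the dual segment of $X_O=L+L_1$ and going through the points of $\mathcal{C}$ in an order compatible with $\preceq$: (A) when $P$ is active, glue a triangle (petal) with vertices the branches of $X_P$ and $E_P$ along the dual segment of $X_P$ (the base of the petal, opposite to the vertex $E_P$), identifying vertices with the same label; (B) for a point $Q\neq O$, if the germ at $Q$ of the current total transform is a cross, this is $X_Q$, whose dual segment is already present; otherwise $X_Q=E+L_Q$ with $E$ the germ of the exceptional divisor and $L_Q$ smooth transversal to it, and one glues the dual segment of $X_Q$ at the vertex $E$. The base edges of the lotus are the dual segment of $X_O$ and the segments glued in this last case. **Correspondence and order.** The edges which are bases of petals are exactly the dual segments of the crosses $X_P$ at the active points $P$; such an edge corresponds to $P$. A base edge corresponds to an inactive point $Q$ if it is the dual segment of $X_Q$. The edge dual to $X_Q$ is higher than the edge dual to $X_P$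 if $P\preceq Q$ and $P\neq Q$. **Multiplicity.** The multiplicity of $A$ at an infinitely near point $P$ is the multiplicity at $P$ (lowest degree of a monomial of a defining series in local coordinates) of the strict transform of $A$ on $S^P$.
   Formalization: Step (1) is amended: weight 1 also goes to the edge of an inactive point when it is a lateral edge of a petal, not a base edge; as written the algorithm fails for A smooth with X_O = A + L_1, X_Q = E_O + A (weight 0, multiplicity 1). *)

(* Defs.v *)
From HB Require Import structures.
From mathcomp Require Import all_boot all_order all_algebra.
From mathcomp Require Import complex.
From mathcomp Require Import boolp classical_sets functions cardinality fsbigop reals.

Set Implicit Arguments.
Unset Strict Implicit.
Unset Printing Implicit Defensive.

Import Order.TTheory GRing.Theory Num.Theory.
Local Open Scope classical_set_scope.
Local Open Scope ring_scope.

(* The local ring C{x,y}: f i j is the coefficient of x^i y^j, and the elements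
   of C{x,y} are the series satisfying [convergent]. Local coordinates are fixed
   on (S,O), so that the ring of germs of functions at O is C{x,y}. *)
Definition series (R : realType) := nat -> nat -> R[i].

Definition convergent {R : realType} (f : series R) : Prop :=
  exists M r : R[i], forall i j, `|f i j| <= M * r ^+ (i + j).

Definition smul {R : realType} (f g : series R) : series R := fun n k =>
  \sum_(i < n.+1) \sum_(j < k.+1) f i j * g (n - i)%N (k - j)%N.

Definition sone {R : realType} : series R :=
  fun i j => ((i == 0%N) && (j == 0%N))%:R.

Definition spow {R : realType} (f : series R) (n : nat) : series R :=
  iter n (smul f) sone.

Definition sx {R : realType} : series R :=
  fun i j => ((i == 1%N) && (j == 0%N))%:R.

(* A convergent series is a unit of C{x,y} exactly when it does not vanish at
   the origin. *)
Definition vanishes {R : realType} (f : series R) : Prop := f 0%N 0%N = 0.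

Definition sdvd {R : realType} (f g : series R) : Prop :=
  exists h, convergent h /\ g = smul f h.

Definition associates {R : realType} (f g : series R) : Prop :=
  exists e, [/\ convergent e, ~ vanishes e & f = smul e g].

Definition irreducible {R : realType} (f : series R) : Prop :=
  [/\ convergent f, vanishes f &
    forall g h, convergent g -> convergent h -> f = smul g h ->
      ~ vanishes g \/ ~ vanishes h].

(* Germs of curves are given by defining series; l = 0 is a branch of f = 0,
   and inclusion of germs of curves is inclusion of their sets of branches. *)
Definition branch {R : realType} (l f : series R) : Prop :=
  irreducible l /\ sdvd l f.

Definition subgerm {R : realType} (f g : series R) : Prop :=
  forall l, branch l f -> branch l g.

Definition reduced_curve {R : realType} (f : series R) : Prop :=
  [/\ convergent f, vanishes f &
    forall g, convergent g -> sdvd (smul g g) f -> ~ vanishes g].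

(* Multiplicity at the origin: lowest degree of a monomial of f (0 if f = 0). *)
Definition has_degree {R : realType} (f : series R) (n : nat) : Prop :=
  exists i j, (i + j)%N = n /\ f i j != 0.

Definition mult0 {R : realType} (f : series R) : nat :=
  xget 0%N [set n | has_degree f n /\
                    forall m, has_degree f m -> (n <= m)%N].

Definition local_coordinates {R : realType} (u v : series R) : Prop :=
  [/\ convergent u, convergent v, vanishes u, vanishes v &
      u 1%N 0%N * v 0%N 1%N - u 0%N 1%N * v 1%N 0%N != 0].

(* Up to changing u by a unit, the reduced divisor uv = 0. *)
Definition is_cross {R : realType} (h : series R) : Prop :=
  exists u v, local_coordinates u v /\ h = smul u v.

Definition normal_crossings {R : realType} (h : series R) : Prop :=
  exists u v e a b, [/\ local_coordinates u v, convergent e, ~ vanishes e &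
    h = smul e (smul (spow u a) (spow v b))].

(* An infinitely near point of O is the sequence of tangent directions leading
   to it from O = [::]. At a point P with local coordinates (x,y), the direction
   [Some c] is the line y = c x and [None] is the line x = 0. The corresponding
   points of E_P carry local coordinates (x',y') for which
     (x,y) = (x', x' (y' + c))   for Some c,
     (x,y) = (x' y', x')         for None;
   in both cases E_P is x' = 0. *)
Definition inpt (R : realType) := seq (option R[i]).

Definition infnear {R : realType} (P Q : inpt R) : bool := prefix P Q.

Definition sinfnear {R : realType} (P Q : inpt R) : bool :=
  infnear P Q && (P != Q).

(* Composition with the chart of the blowup of the origin. *)
Definition pull1 {R : realType} (c : option R[i]) (f : series R) : series R :=
  fun n k =>
    if c is Some a then
      \sum_(j < n.+1) f (n - j)%N j * 'C(j, k)%:R * a ^+ (j - k)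
    else if (k <= n)%N then f k (n - k)%N else 0.

Definition strict1 {R : realType} (c : option R[i]) (f : series R) : series R :=
  fun n k => pull1 c f (n + mult0 f)%N k.

Fixpoint pull {R : realType} (s : inpt R) (f : series R) : series R :=
  if s is c :: s' then pull s' (pull1 c f) else f.

Fixpoint strict {R : realType} (s : inpt R) (f : series R) : series R :=
  if s is c :: s' then strict s' (strict1 c f) else f.

(* Germs at Q of the total and strict transforms of a germ f at P, when Q is
   infinitely near P. *)
Definition total_at {R : realType} (P Q : inpt R) (f : series R) : series R :=
  pull (drop (size P) Q) f.

Definition strict_at {R : realType} (P Q : inpt R) (f : series R) : series R :=
  strict (drop (size P) Q) f.

Definition multiplicity {R : realType} (f : series R) (P : inpt R) : nat :=
  mult0 (strict_at [::] P f).

(* A model is given by the finite set of points which are blown up. *)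
Definition constellation {R : realType} (D : set (inpt R)) : Prop :=
  forall P Q, D Q -> infnear P Q -> D P.

Definition is_model {R : realType} (D : set (inpt R)) : Prop :=
  finite_set D /\ constellation D.

Definition on_model {R : realType} (D : set (inpt R)) (P : inpt R) : Prop :=
  ~ D P /\ forall Q, sinfnear Q P -> D Q.

Definition embedded_resolution {R : realType} (D : set (inpt R))
    (f : series R) : Prop :=
  is_model D /\ forall P, on_model D P -> normal_crossings (total_at [::] P f).

(* Only the values of [cross] at the points of [pts] are relevant; they are
   defining series of the crosses. *)
Record crosses (R : realType) := Crosses {
  pts : set (inpt R);
  active : set (inpt R);
  cross : inpt R -> series R }.

Definition nonmaximal {R : realType} (D : set (inpt R)) : set (inpt R) :=
  [set P | D P /\ exists Q, D Q /\ sinfnear P Q].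

Definition active_constellation_of_crosses {R : realType}
    (K : crosses R) : Prop :=
  [/\ constellation (pts K),
      active K `<=` pts K,
      nonmaximal (pts K) `<=` active K,
      forall P, pts K P -> is_cross (cross K P) &
      forall P Q, pts K P -> pts K Q -> infnear P Q ->
        subgerm (total_at P Q (cross K P)) (cross K Q)].

Definition inactive {R : realType} (K : crosses R) (P : inpt R) : Prop :=
  pts K P /\ ~ active K P.

(* The branches at P of the total transform of all the crosses. *)
Definition total_cross_branch {R : realType} (K : crosses R) (P : inpt R)
    (l : series R) : Prop :=
  exists Q, [/\ pts K Q, infnear Q P & branch l (total_at Q P (cross K Q))].

Definition adapted_via {R : realType} (K : crosses R) (f : series R)
    (D : set (inpt R)) : Prop :=
  [/\ embedded_resolution D f,
      pts K = [set P | exists D', [/\ is_model D', D' `<=` D, on_model D' P &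
                                      vanishes (strict_at [::] P f)]],
      active K = nonmaximal (pts K) &
      forall P, on_model D P -> forall l,
        branch l (total_at [::] P f) -> total_cross_branch K P l].

Definition adapted {R : realType} (K : crosses R) (f : series R) : Prop :=
  exists D, adapted_via K f D.

(* The germ at Q of the total transform of the crosses at the points preceding
   Q is a cross. *)
Definition transform_is_cross {R : realType} (K : crosses R)
    (Q : inpt R) : Prop :=
  exists h, is_cross h /\ forall l, branch l h <->
    exists P, [/\ pts K P, sinfnear P Q & branch l (total_at P Q (cross K P))].

Definition fresh {R : realType} (K : crosses R) (Q : inpt R) : Prop :=
  Q = [::] \/ ~ transform_is_cross K Q.

(* Vertices of the lotus: [LabL] is L, [LabLine [::]] is L_1, [LabLine Q] is
   L_Q when Q <> O, and [LabExc P] is E_P. *)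
Inductive label (R : realType) :=
  | LabL
  | LabLine of inpt R
  | LabExc of inpt R.
Arguments LabL {R}.

(* [lineL] is a series defining L at O, and [line Q] a series defining L_Q at
   Q (L_1 for Q = O), which is relevant only for Q fresh. *)
Definition names_lines {R : realType} (K : crosses R)
    (lineL : series R) (line : inpt R -> series R) : Prop :=
  [/\ local_coordinates lineL (line [::]),
      associates (cross K [::]) (smul lineL (line [::])) &
      forall Q, pts K Q -> Q != [::] -> fresh K Q ->
        local_coordinates sx (line Q) /\
        associates (cross K Q) (smul sx (line Q))].

(* Germ at P of the strict transform of the labelled curve, the empty germ
   being defined by [sone]. *)
Definition label_germ {R : realType} (lineL : series R)
    (line : inpt R -> series R) (u : label R) (P : inpt R) : series R :=
  match u with
  | LabL => strict_at [::] P lineL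
  | LabLine Q => if infnear Q P then strict_at Q P (line Q) else sone
  | LabExc Q =>
      if sinfnear Q P then strict (drop (size Q).+1 P) sx else sone
  end.

Definition is_label {R : realType} (K : crosses R) (u : label R) : Prop :=
  match u with
  | LabL => True
  | LabLine Q => pts K Q /\ fresh K Q
  | LabExc Q => active K Q
  end.

(* The two labels of the branches of the cross at P. *)
Definition dual_segment {R : realType} (K : crosses R) (lineL : series R)
    (line : inpt R -> series R) (P : inpt R) : set (label R) :=
  [set u | is_label K u /\ branch (label_germ lineL line u P) (cross K P)].

(* [faces] is an abstract simplicial complex; a petal is recorded as the pair
   of its base and of the vertex opposite to it. *)
Record lotus (R : realType) := Lotus {
  faces : set (set (label R));
  petals : set (set (label R) * label R);
  base_edges : set (set (label R)) }.

Definition simplex {R : realType} (s : set (label R)) : set (set (label R)) :=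
  [set t | t `<=` s /\ t !=set0].

Definition glue_segment {R : realType} (e : set (label R))
    (T : lotus R) : lotus R :=
  Lotus (faces T `|` simplex e) (petals T) (base_edges T `|` [set e]).

Definition glue_petal {R : realType} (e : set (label R)) (v : label R)
    (T : lotus R) : lotus R :=
  Lotus (faces T `|` simplex (e `|` [set v])) (petals T `|` [set (e, v)])
    (base_edges T).

Definition lotus_step {R : realType} (K : crosses R) (lineL : series R)
    (line : inpt R -> series R) (T : lotus R) (P : inpt R) : lotus R :=
  let e := dual_segment K lineL line P in
  let T' := if (P != [::]) && `[< fresh K P >] then glue_segment e T else T in
  if `[< active K P >] then glue_petal e (LabExc P) T' else T'.

Definition lotus_start {R : realType} (K : crosses R) (lineL : series R)
    (line : inpt R -> series R) : lotus R :=
  glue_segment (dual_segment K lineL line [::]) (Lotus set0 set0 set0).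

Definition lotus_of {R : realType} (K : crosses R) (lineL : series R)
    (line : inpt R -> series R) (s : seq (inpt R)) : lotus R :=
  foldl (lotus_step K lineL line) (lotus_start K lineL line) s.

Definition compatible_order {R : realType} (K : crosses R)
    (s : seq (inpt R)) : Prop :=
  [/\ uniq s, pts K = [set P | P \in s] &
      forall P Q, P \in s -> Q \in s -> infnear P Q ->
        (index P s <= index Q s)%N].

Definition petal_base {R : realType} (T : lotus R) (e : set (label R)) : Prop :=
  exists v, petals T (e, v).

Definition higher {R : realType} (K : crosses R) (lineL : series R)
    (line : inpt R -> series R) (e e' : set (label R)) : Prop :=
  exists P Q, [/\ pts K P, pts K Q, sinfnear P Q,
    e = dual_segment K lineL line P & e' = dual_segment K lineL line Q].

(* [edge_weight .. e n]: the algorithm attaches the weight n to e. When a branch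
   of the curve is also a branch of the cross at an earlier point, the edge of
   the corresponding inactive point is a lateral edge of a petal instead of a
   base edge; [weight_lateral] gives it the weight 1 too. *)
Inductive edge_weight {R : realType} (K : crosses R) (lineL : series R)
    (line : inpt R -> series R) (T : lotus R) : set (label R) -> nat -> Prop :=
  | weight_base e Q :
      base_edges T e -> inactive K Q -> e = dual_segment K lineL line Q ->
      edge_weight K lineL line T e 1%N
  | weight_lateral e Q :
      ~ base_edges T e -> inactive K Q -> e = dual_segment K lineL line Q ->
      edge_weight K lineL line T e 1%N
  | weight_petal e v (w : set (label R) -> nat) :
      petals T (e, v) ->
      (forall e', higher K lineL line e e' -> e' v ->
        edge_weight K lineL line T e' (w e')) ->
      edge_weight K lineL line T e
        (\sum_(e' \in [set e' | higher K lineL line e e' /\ e' v]) w e')%R.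

(* Main.v *)
Require Import Defs.
From HB Require Import structures.
From mathcomp Require Import all_boot all_order all_algebra.
From mathcomp Require Import complex zify ring.
From mathcomp Require Import boolp classical_sets functions cardinality fsbigop reals.

Set Implicit Arguments.
Unset Strict Implicit.
Unset Printing Implicit Defensive.

Import Order.TTheory GRing.Theory Num.Theory.
Local Open Scope classical_set_scope.
Local Open Scope ring_scope.

(* The multiplicity of A at an active point P is the sum of its multiplicities
   at the points proximate to P, i.e. the points of the strict transforms of
   E_P. Indeed it is the sum of the intersection numbers of the strict
   transform of A with E_P at the points P.c; and blowing up a point of E_P
   decreases the intersection number with E_P by the multiplicity there, until
   one reaches a point where the total transform has normal crossings, at which
   A and E_P are smooth and transversal. The points proximate to P are exactly
   those whose dual segment has E_P as a vertex, so the algorithm computes this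
   sum. That the maximal points have multiplicity 1 uses that A is reduced: a
   multiple smooth component of a strict transform would descend to a square
   factor of A, by Weierstrass division in C{x,y}. *)

(* Order.Theory also exports a [sdvd]. *)
Local Notation sdvd := Defs.sdvd.

(** * The ring of power series *)

(** The charts are chosen so that at every point other than O the last exceptional curve is x = 0,
    while an older exceptional curve through the point, if any, is y = 0. Intersection numbers with
    exceptional curves are therefore orders of one-variable series: of the row [f 0], or of the row
    0 of the series with x and y exchanged. No factoriality of C{x,y} is used: the components that
    must be split off are smooth, and smooth germs are prime because the remainders of Weierstrass
    division by them depend on one variable only. Weights are attached to edges, that is to sets of
    labels, whereas multiplicities belong to points. The passage between the two rests on
    [dual_inj]: distinct points have distinct dual segments. This in turn requires showing that the
    branches of each cross are strict transforms of labelled curves, although the crosses are only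
    constrained by inclusions. *)

Definition ps (B : Type) := nat -> B.

Section PowerSeriesRing.
Variable B : comNzRingType.
Implicit Types f g h : ps B.

HB.instance Definition _ := gen_eqMixin (ps B).
HB.instance Definition _ := gen_choiceMixin (ps B).

Let psadd f g : ps B := fun n => f n + g n.
Let psopp f : ps B := fun n => - f n.
Let psmul f g : ps B := fun n => \sum_(i < n.+1) f i * g (n - i)%N.
Let psone : ps B := fun n => (n == 0%N)%:R.

Let psaddA : associative psadd.
Proof. by move=> f g h; apply/funext => n; rewrite /psadd addrA. Qed.
Let psaddC : commutative psadd.
Proof. by move=> f g; apply/funext => n; rewrite /psadd addrC. Qed.
Let psadd0 : left_id (fun _ => 0 : B) psadd.
Proof. by move=> f; apply/funext => n; rewrite /psadd add0r. Qed.
Let psaddN : left_inverse (fun _ => 0 : B) psopp psadd.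
Proof. by move=> f; apply/funext => n; rewrite /psadd /psopp addNr. Qed.

HB.instance Definition _ :=
  GRing.isZmodule.Build (ps B) psaddA psaddC psadd0 psaddN.

Let psmulC : commutative psmul.
Proof.
move=> f g; apply/funext => n; rewrite /psmul (reindex_inj rev_ord_inj) /=.
by apply: eq_bigr => i _; rewrite mulrC subSS subKn // -ltnS.
Qed.

(* Associativity is inherited from polynomials through truncation. *)
Let psmul_trunc f g n N : (n < N)%N ->
  psmul f g n = ((\poly_(i < N) f i) * (\poly_(i < N) g i))`_n.
Proof.
move=> nN; rewrite coefM; apply: eq_bigr => i _.
have iN : (i < N)%N := leq_ltn_trans (leq_ord i) nN.
by rewrite !coef_poly iN (leq_ltn_trans (leq_subr _ _) nN).
Qed.

Let psmulA : associative psmul.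
Proof.
move=> f g h; apply/funext => n.
pose t (u : ps B) : {poly B} := \poly_(i < n.+1) u i.
have E u v (w : {poly B}) : (forall i, (i <= n)%N -> u i = w`_i) ->
    psmul u v n = (w * t v)`_n /\ psmul v u n = (t v * w)`_n.
  move=> uw; have H : psmul u v n = (w * t v)`_n.
    rewrite coefM; apply: eq_bigr => i _.
    by rewrite uw ?leq_ord // coef_poly ltnS leq_subr.
  by rewrite [psmul v u]psmulC [t v * w]mulrC.
have trunc u v i (H : (i < n.+1)%N) := psmul_trunc u v H.
have [_ ->] := E (psmul g h) f (t g * t h) (trunc g h).
have [-> _] := E (psmul f g) h (t f * t g) (trunc f g).
by rewrite mulrA.
Qed.

Let psmul1 : left_id psone psmul.
Proof.
move=> f; apply/funext => n; rewrite /psmul big_ord_recl mul1r subn0.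
by rewrite big1 ?addr0 // => i _; rewrite /psone mul0r.
Qed.

Let psmulDl : left_distributive psmul psadd.
Proof.
move=> f g h; apply/funext => n; rewrite /psadd /psmul -big_split.
by apply: eq_bigr => i _; rewrite mulrDl.
Qed.

Let psone_neq0 : psone != (0 : ps B).
Proof.
by apply/eqP => /(congr1 (fun f : ps B => f 0%N))/eqP; rewrite oner_eq0.
Qed.

HB.instance Definition _ := GRing.Zmodule_isComNzRing.Build (ps B)
  psmulA psmulC psmul1 psmulDl psone_neq0.

Lemma psDE f g n : (f + g) n = f n + g n. Proof. by []. Qed.
Lemma psME f g n : (f * g) n = \sum_(i < n.+1) f i * g (n - i)%N.
Proof. by []. Qed.

Lemma ps_sumE I (r : seq I) (P : pred I) (F : I -> ps B) n :
  (\sum_(i <- r | P i) F i) n = \sum_(i <- r | P i) F i n.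
Proof. by elim/big_rec2: _ => // i x y _ <-. Qed.

Lemma psM0 f g : (f * g) 0%N = f 0%N * g 0%N.
Proof. by rewrite psME big_ord1. Qed.

(** A relation, so that the zero series has no order. It is used at two levels: for series in y with
    coefficients in C, and for series in x whose coefficients are series in y, where it is the order
    along x = 0. *)
Definition is_ord f n := f n != 0 /\ forall i, (i < n)%N -> f i = 0.

Lemma is_ord_uniq f m n : is_ord f m -> is_ord f n -> m = n.
Proof.
move=> [fm m0] [fn n0]; case: (ltngtP m n) => // [/n0|/m0] E.
  by rewrite E eqxx in fm.
by rewrite E eqxx in fn.
Qed.

Lemma is_ord_ex f : f != 0 -> exists n, is_ord f n.
Proof.
move=> f0; have ex' : exists n, f n != 0.
  apply: contrapT => /forallNP H; case/eqP: f0; apply/funext => n.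
  by have [//|/H] := eqVneq (f n) 0.
exists (ex_minn ex'); case: ex_minnP => n fn H; split => // i ni.
by apply/eqP/negPn/negP => /H; rewrite leqNgt ni.
Qed.

Lemma is_ord_neq0 f n : is_ord f n -> f != 0.
Proof. by move=> [+ _]; apply: contraNneq => ->. Qed.

Definition no_zero_divisors (A : comNzRingType) :=
  forall a b : A, a * b = 0 -> a = 0 \/ b = 0.

Lemma is_ordM_coef f g m n : is_ord f m -> is_ord g n ->
  (f * g) (m + n)%N = f m * g n.
Proof.
move=> [_ f0] [_ g0]; rewrite psME.
have mn : (m < (m + n).+1)%N by rewrite ltnS leq_addr.
rewrite (bigD1 (Ordinal mn)) //= addKn big1 ?addr0 // => i im.
case: (ltngtP i m) => [/f0 ->|mi|E]; rewrite ?mul0r //.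
  by rewrite g0 ?mulr0 //; have := leq_ord i; lia.
by case/eqP: im; apply/val_inj.
Qed.

Lemma is_ordM f g m n : no_zero_divisors B ->
  is_ord f m -> is_ord g n -> is_ord (f * g) (m + n)%N.
Proof.
move=> dB om on; split; rewrite ?(is_ordM_coef om on).
  by apply/eqP => /dB []; apply/eqP; [case: om | case: on].
move=> k kmn; rewrite psME big1 // => i _.
case: om on => [_ f0] [_ g0].
have [/f0 ->|mi] := ltnP i m; rewrite ?mul0r // g0 ?mulr0 //.
by have := leq_ord i; lia.
Qed.

Lemma ps_no_zero_divisors : no_zero_divisors B -> no_zero_divisors (ps B).
Proof.
move=> dB f g fg0; have [->|f0] := eqVneq f 0; first by left.
have [->|g0] := eqVneq g 0; first by right.
have [m om] := is_ord_ex f0; have [n on] := is_ord_ex g0.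
by have := is_ord_neq0 (is_ordM dB om on); rewrite fg0 eqxx.
Qed.

End PowerSeriesRing.

(** A series is read as a power series in x whose coefficients, the rows, are series in y; [f 0] is
    the restriction to x = 0. *)
HB.instance Definition _ (R : realType) :=
  GRing.ComNzRing.copy (series R) (ps (ps R[i])).

(** * Series in two variables and the charts of a blowup *)

Section Series.
Variable R : realType.
Local Notation C := R[i].
Local Notation series := (series R).
Implicit Types f g h u v : series.

Lemma serDE f g i j : (f + g) i j = f i j + g i j. Proof. by []. Qed.
Lemma serNE f i j : (- f) i j = - f i j. Proof. by []. Qed.
Lemma serME f g n k : (f * g) n k =
  \sum_(i < n.+1) \sum_(j < k.+1) f i j * g (n - i)%N (k - j)%N.
Proof. by rewrite [LHS](ps_sumE (B := C)). Qed.

Lemma smulE f g : smul f g = f * g.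
Proof. by apply/funext => n; apply/funext => k; rewrite serME. Qed.

Lemma soneE : sone = 1 :> series.
Proof. by apply/funext => -[|i]; apply/funext => -[|j]. Qed.

Lemma spowE f n : spow f n = f ^+ n.
Proof. by elim: n => [|n IH]; rewrite /= ?soneE // exprS -IH -smulE. Qed.

Lemma series_no_zero_divisors : no_zero_divisors series.
Proof.
apply: (@ps_no_zero_divisors (ps C)); apply: ps_no_zero_divisors => a b /eqP.
by rewrite mulf_eq0 => /orP[] /eqP; [left|right].
Qed.

Lemma row_no_zero_divisors : no_zero_divisors (ps C).
Proof.
apply: ps_no_zero_divisors => a b /eqP.
by rewrite mulf_eq0 => /orP[] /eqP; [left|right].
Qed.

Lemma series_mulf_neq0 f g : f != 0 -> g != 0 -> f * g != 0.
Proof. by move=> /eqP f0 /eqP g0; apply/eqP => /series_no_zero_divisors []. Qed.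

Lemma series_mulI f g h : f != 0 -> f * g = f * h -> g = h.
Proof.
move=> /eqP f0 /eqP; rewrite -subr_eq0 -mulrBr => /eqP.
by move=> /series_no_zero_divisors [//|/eqP]; rewrite subr_eq0 => /eqP.
Qed.

Lemma series_expf_neq0 f n : f != 0 -> f ^+ n != 0.
Proof.
move=> f0; elim: n => [|n IH]; rewrite ?expr0 ?oner_eq0 //.
by rewrite exprS series_mulf_neq0.
Qed.

Definition swap f : series := fun i j => f j i.

Lemma swapM f g : swap (f * g) = swap f * swap g.
Proof.
apply/funext => n; apply/funext => k.
by rewrite /swap !serME exchange_big.
Qed.

Lemma swapK f : swap (swap f) = f. Proof. by []. Qed.

Lemma swap1 : swap 1 = 1 :> series.
Proof. by rewrite -!soneE; apply/funext => -[|i]; apply/funext => -[|j]. Qed.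

Definition sy : series := swap sx.

Lemma sxME n f i j : (sx ^+ n * f) i j = if (n <= i)%N then f (i - n)%N j else 0.
Proof.
elim: n f i j => [|n IH] f i j; first by rewrite mul1r subn0.
rewrite exprSr -mulrA IH.
have sx1 k : (sx * f) k j = if k is k'.+1 then f k' j else 0.
  rewrite serME; case: k => [|k].
    by rewrite big_ord1 big1 // => l _; rewrite mul0r.
  rewrite big_ord_recl big1 => [|l _]; last by rewrite mul0r.
  rewrite add0r big_ord_recl /= big_ord_recl /= mul1r subSS !subn0.
  rewrite big1 ?addr0 => [|l _].
    rewrite big1 ?addr0 // => i0 _; rewrite big1 // => l _.
    by rewrite mul0r.
  by rewrite mul0r.
rewrite sx1; case: (ltngtP n i) => [ni|//|->]; last by rewrite subnn.
by have -> : (i - n = (i - n.+1).+1)%N by lia.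
Qed.

Lemma sx_neq0 : sx != 0 :> series.
Proof.
by apply/eqP => /(congr1 (fun f : series => f 1%N 0%N)) /eqP; rewrite oner_eq0.
Qed.

Lemma row0_sxM f : (sx * f) 0%N = 0.
Proof. by apply/funext => j; rewrite -[sx]expr1 sxME. Qed.

Lemma shift_row n f : (forall i j, (i < n)%N -> f i j = 0) ->
  f = sx ^+ n * (fun i j => f (i + n)%N j : C).
Proof.
move=> f0; apply/funext => i; apply/funext => j; rewrite sxME.
by case: (leqP n i) => [ni|/f0 //]; rewrite subnK.
Qed.

(** The homogeneous part of degree n, dehomogenised at x = 1. *)
Definition homog n f : {poly C} := \poly_(j < n.+1) f (n - j)%N j.

Lemma homogM n f g :
  homog n (f * g) = \sum_(i < n.+1) homog i f * homog (n - i) g.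
Proof.
apply/polyP => j; rewrite coef_poly coef_sum.
under eq_bigr => i _ do rewrite coefM.
under eq_bigr => i _ do under eq_bigr => b _ do rewrite !coef_poly.
rewrite exchange_big /=; case: ltnP => jn; last first.
  rewrite big1 // => b _; rewrite big1 // => i _.
  case: ltnP => bi; rewrite ?mul0r //; case: ltnP => ij; rewrite ?mulr0 //.
  by have := leq_ord i; have := leq_ord b; lia.
rewrite serME exchange_big; apply: eq_bigr => b _ /=.
have bj := leq_ord b.
rewrite [RHS](bigID (fun i : 'I_n.+1 => (b <= i)%N && (j - b <= n - i)%N)) /=.
rewrite [RHS]addrC [X in _ = X + _]big1 ?add0r => [|i]; last first.
  by rewrite !ltnS negb_and => /orP[] /negPf ->; rewrite ?mul0r ?mulr0.
(* With b the y-exponent and i the total degree of the monomial taken from f, its x-exponent is a =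
   i - b. *)
rewrite (reindex_onto (fun a : 'I_(n - j).+1 => inord (a + b) : 'I_n.+1)
   (fun i => inord (i - b))) /=.
  apply: eq_big => [a|a _].
    have := leq_ord a => ?; rewrite inordK ?addnK ?inord_val ?eqxx ?andbT; lia.
  have := leq_ord a => ?; rewrite inordK; last lia.
  rewrite !ifT; try lia.
  by congr (f _ _ * g _ _); lia.
move=> i /andP[bi ij]; have := leq_ord i => ?; apply/val_inj => /=.
by rewrite !inordK; lia.
Qed.

(** The coefficient of x^n in f(x, x (y + a)) is the degree n part of f at (1, y + a). *)
Lemma pull1_SomeE a f n k :
  pull1 (Some a) f n k = (homog n f \Po ('X + a%:P))`_k.
Proof.
rewrite /homog poly_def rmorph_sum /= coef_sum; apply: eq_bigr => j _.
rewrite linearZ /= comp_Xn_poly coefZ -mulrA; congr (_ * _).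
rewrite addrC exprDn coef_sum; case: (leqP k j) => kj.
  have kj' : (k < j.+1)%N by [].
  rewrite (bigD1 (Ordinal kj')) //= big1 => [|i ik].
    by rewrite addr0 coefMn -polyC_exp coefCM coefXn eqxx mulr1 mulr_natl.
  rewrite coefMn -polyC_exp coefCM coefXn.
  case: (k =P i) ik => [E|_ _]; last by rewrite mulr0 mul0rn.
  by case/eqP; apply/val_inj.
rewrite bin_small // mul0r big1 // => i _.
rewrite coefMn -polyC_exp coefCM coefXn.
case: (k =P i) => [E|_]; last by rewrite mulr0 mul0rn.
by have := leq_ord i; lia.
Qed.

(** Exchanging the coordinates turns the vertical direction into y = 0, so that facts on [None] can
    be deduced from [Some 0]. *)
Lemma pull1_NoneE f : pull1 None f = pull1 (Some 0) (swap f).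
Proof.
apply/funext => n; apply/funext => k; rewrite pull1_SomeE addr0 comp_polyXr.
by rewrite coef_poly /= /swap ltnS.
Qed.

Lemma pull1M c f g : pull1 c (f * g) = pull1 c f * pull1 c g.
Proof.
have H a (u v : series) :
    pull1 (Some a) (u * v) = pull1 (Some a) u * pull1 (Some a) v.
  apply/funext => n; apply/funext => k; rewrite pull1_SomeE homogM serME.
  rewrite rmorph_sum coef_sum; apply: eq_bigr => i _.
  by rewrite rmorphM /= coefM; apply: eq_bigr => j _; rewrite -!pull1_SomeE.
by case: c => [a|]; rewrite ?pull1_NoneE ?swapM H.
Qed.

Lemma pull1D c f g : pull1 c (f + g) = pull1 c f + pull1 c g.
Proof.
apply/funext => n; apply/funext => k; rewrite serDE /pull1.
case: c => [a|]; last by case: ifP; rewrite ?addr0.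
by rewrite -big_split; apply: eq_bigr => j _; rewrite serDE !mulrDl.
Qed.

Lemma homog1 n : homog n 1 = (n == 0%N)%:R.
Proof.
apply/polyP => j; rewrite coef_poly -soneE /sone coefMn coef1.
by case: n j => [|n] [|j] //=; rewrite ?andbF ?subn0 /= ?mul0rn //; case: ifP.
Qed.

Lemma pull1_1 c : pull1 c 1 = 1 :> series.
Proof.
have H a : pull1 (Some a) 1 = 1 :> series.
  apply/funext => n; apply/funext => k; rewrite pull1_SomeE homog1.
  rewrite rmorph_nat coefMn coef1 -soneE /sone.
  by case: (n == 0%N); rewrite ?mulr0n.
by case: c => [a|]; rewrite ?pull1_NoneE ?swap1 H.
Qed.

End Series.
Arguments sy {R}.

(** * Total and strict transforms *)

Section Blowup.
Variable R : realType.
Local Notation C := R[i].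
Local Notation series := (series R).
Implicit Types f g h u v : series.

(** Row n is the degree n part of f up to an invertible substitution, y -> y + a or the reversal of
    coefficients. Hence the order of the pullback along the exceptional curve is the multiplicity,
    whatever the direction. *)
Lemma pull1_row_eq0 c f n :
  pull1 c f n = 0 <-> forall i j, (i + j)%N = n -> f i j = 0.
Proof.
have H a (g : series) : pull1 (Some a) g n = 0 ->
    forall i j, (i + j)%N = n -> g i j = 0.
  move=> g0 i j E; have : homog n g = 0.
    rewrite -[LHS](comp_polyXaddC_K _ a).
    suff -> : homog n g \Po ('X + a%:P) = 0 by rewrite comp_poly0.
    by apply/polyP => k; rewrite -pull1_SomeE g0 coef0.
  by move=> /polyP/(_ j); rewrite coef_poly coef0 -E ltnS leq_addl addnK.
split=> [|f0].
  case: c => [a|]; first exact: H.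
  by rewrite pull1_NoneE => /H f0 i j E; apply: (f0 j i); rewrite addnC.
apply/funext => k; rewrite /pull1; case: c => [a|].
  by rewrite big1 // => j _; rewrite f0 ?mul0r // subnK // -ltnS.
by case: ifP => // kn; rewrite f0 // subnKC.
Qed.

Lemma is_ord_pull1_mult0 c f n : is_ord (pull1 c f) n -> mult0 f = n.
Proof.
move=> [fn f0]; have Dn m : has_degree f m -> (n <= m)%N.
  move=> [i [j [E fij]]]; rewrite leqNgt; apply/negP => /f0 /pull1_row_eq0.
  by move=> /(_ i j E) f0'; rewrite f0' eqxx in fij.
have dn : has_degree f n.
  apply: contrapT => H; case/eqP: fn; apply/pull1_row_eq0 => i j E.
  by apply: contrapT => /eqP fij; apply: H; exists i, j.
by apply: xget_unique => // m [dm Dm]; apply/eqP; rewrite eqn_leq Dm // Dn.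
Qed.

Lemma pull1_neq0 c f : f != 0 -> pull1 c f != 0.
Proof.
apply: contraNneq => f0; apply/eqP/funext => i; apply/funext => j.
by have /pull1_row_eq0/(_ i j erefl) : pull1 c f (i + j)%N = 0 by rewrite f0.
Qed.

Lemma is_ord_pull1 c f : f != 0 -> is_ord (pull1 c f) (mult0 f).
Proof.
move=> /(pull1_neq0 c)/(@is_ord_ex (ps C)) [n on].
by rewrite (is_ord_pull1_mult0 on).
Qed.

Lemma pull1_strict1 c f : f != 0 -> pull1 c f = sx ^+ mult0 f * strict1 c f.
Proof.
move=> /(is_ord_pull1 c) [_ f0].
by apply: shift_row => i j /f0 ->.
Qed.

Lemma strict1_row0 c f : f != 0 -> strict1 c f 0%N != 0.
Proof. by case/(is_ord_pull1 c). Qed.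

Lemma row0_neq0 f : f 0%N != 0 -> f != 0.
Proof. by apply: contraNneq => ->. Qed.

Lemma strict1_neq0 c f : f != 0 -> strict1 c f != 0.
Proof. by move=> /(strict1_row0 c)/row0_neq0. Qed.

Lemma is_ord_sxM n g : g 0%N != 0 -> is_ord (sx ^+ n * g : ps (ps C)) n.
Proof.
move=> g0; split=> [|i ni]; last first.
  by apply/funext => j; rewrite sxME leqNgt ni.
apply: contraNneq g0 => H; apply/eqP/funext => j.
by have := congr1 (fun r : ps C => r j) H; rewrite sxME leqnn subnn.
Qed.

(** Since x does not divide g, the factorization determines both n and g. Multiplicities and strict
    transforms are computed through this criterion. *)
Lemma strict1_unique c f n g : pull1 c f = sx ^+ n * g -> g 0%N != 0 ->
  mult0 f = n /\ strict1 c f = g.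
Proof.
move=> E g0; have fn : mult0 f = n.
  by apply: (@is_ord_pull1_mult0 c); rewrite E; apply: is_ord_sxM.
split=> //; apply/funext => i; apply/funext => j.
by rewrite /strict1 fn E sxME leq_addl addnK.
Qed.

Lemma row0_mulf_neq0 f g : f 0%N != 0 -> g 0%N != 0 -> (f * g) 0%N != 0.
Proof.
move=> /eqP f0 /eqP g0; apply/eqP.
by rewrite (psM0 (f : ps (ps C))) => /row_no_zero_divisors [].
Qed.

Lemma strict1M_mult0M c f g : f != 0 -> g != 0 ->
  mult0 (f * g) = (mult0 f + mult0 g)%N /\
  strict1 c (f * g) = strict1 c f * strict1 c g.
Proof.
move=> f0 g0; apply: strict1_unique; last by rewrite row0_mulf_neq0 ?strict1_row0.
by rewrite pull1M !pull1_strict1 // exprD mulrACA.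
Qed.

Lemma strict1M c f g : f != 0 -> g != 0 ->
  strict1 c (f * g) = strict1 c f * strict1 c g.
Proof. by move=> f0 g0; case: (strict1M_mult0M c f0 g0). Qed.

Lemma pull1_sx a : pull1 (Some a) sx = sx :> series.
Proof.
apply/funext => n; apply/funext => k; rewrite pull1_SomeE.
have -> : homog n (sx : series) = (n == 1%N)%:R.
  apply/polyP => j; rewrite coef_poly coefMn coef1 /sx.
  by case: n j => [|[|n]] [|j] //=; rewrite ?andbF ?mul0rn //; case: ifP.
rewrite /sx; case: eqP => _; first by rewrite rmorph1 coef1 andTb.
by rewrite rmorph0 coef0.
Qed.

Lemma pull1_sy a :
  pull1 (Some a) sy = sx * (sy + (fun i j => a * (1 : series) i j)) :> series.
Proof.
apply/funext => n; apply/funext => k; rewrite pull1_SomeE -[sx]expr1 sxME.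
have -> : homog n (sy : series) = 'X *+ (n == 1%N).
  apply/polyP => j; rewrite coef_poly coefMn coefX /sy /swap /sx.
  by case: n j => [|[|n]] [|[|j]] //=; rewrite ?andbF ?mul0rn //; case: ifP.
case: n => [|[|n]]; rewrite ?mulr0n ?rmorph0 ?coef0 //=; last first.
  by rewrite serDE -soneE /sone /sy /swap /sx /= andbF mulr0 addr0.
rewrite mulr1n comp_polyX coefD coefX coefC serDE -soneE /sone /sy /swap /sx /=.
by rewrite andbT; case: (k =P 0%N) => _; rewrite ?mulr1 ?mulr0.
Qed.

Lemma pull1_None_sx : pull1 None sx = sx * sy :> series.
Proof.
rewrite pull1_NoneE -/sy pull1_sy; congr (_ * _).
by apply/funext => i; apply/funext => j; rewrite serDE mul0r addr0.
Qed.

Lemma pull1_None_sy : pull1 None sy = sx :> series.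
Proof. by rewrite pull1_NoneE /sy swapK pull1_sx. Qed.

Lemma one_row0 : (1 : series) 0%N != 0.
Proof. by apply/eqP => /(congr1 (fun r : ps C => r 0%N)) /eqP; rewrite oner_eq0. Qed.

Lemma sy_row0 : (sy : series) 0%N != 0.
Proof. by apply/eqP => /(congr1 (fun r : ps C => r 1%N)) /eqP; rewrite oner_eq0. Qed.

Lemma sy_neq0 : sy != 0 :> series.
Proof. exact: row0_neq0 sy_row0. Qed.

Lemma strict1_sx a : strict1 (Some a) sx = 1 :> series.
Proof.
by apply: (proj2 (@strict1_unique _ _ 1 _ _ one_row0)); rewrite pull1_sx mulr1.
Qed.

Lemma strict1_None_sx : strict1 None sx = sy :> series.
Proof.
by apply: (proj2 (@strict1_unique _ _ 1 _ _ sy_row0)); rewrite pull1_None_sx.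
Qed.

Lemma strict1_None_sy : strict1 None sy = 1 :> series.
Proof.
by apply: (proj2 (@strict1_unique _ _ 1 _ _ one_row0)); rewrite pull1_None_sy mulr1.
Qed.

Lemma strict1_0_sy : strict1 (Some 0) sy = sy :> series.
Proof.
apply: (proj2 (@strict1_unique _ _ 1 _ _ sy_row0)); rewrite pull1_sy; congr (_ * _).
by apply/funext => i; apply/funext => j; rewrite serDE mul0r addr0.
Qed.

Lemma mult0_unit f : f 0%N 0%N != 0 -> mult0 f = 0%N.
Proof.
move=> f0; apply: (@is_ord_pull1_mult0 None); split=> //.
by apply: contraNneq f0 => /pull1_row_eq0/(_ 0%N 0%N erefl) ->.
Qed.

Lemma mult0_gt0 f : f != 0 -> f 0%N 0%N = 0 -> (0 < mult0 f)%N.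
Proof.
move=> f0 f00; rewrite lt0n; apply/eqP => E; have [/eqP] := is_ord_pull1 None f0.
case; rewrite E; apply/pull1_row_eq0 => i j /eqP; rewrite addn_eq0.
by move=> /andP[/eqP-> /eqP->].
Qed.

Lemma strict1_unit c f : f 0%N 0%N != 0 -> strict1 c f 0%N 0%N != 0.
Proof.
move=> f0; rewrite /strict1 mult0_unit // /pull1; case: c => [a|//].
by rewrite big_ord1 expr0 !mulr1.
Qed.

Definition smooth f := f 0%N 0%N = 0 /\ (f 1%N 0%N != 0 \/ f 0%N 1%N != 0).

Definition jacobian f g := f 1%N 0%N * g 0%N 1%N - f 0%N 1%N * g 1%N 0%N.

Lemma smooth_neq0 f : smooth f -> f != 0.
Proof. by case=> _ H; apply/eqP => E; case: H; rewrite E eqxx. Qed.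

Lemma mult0_smooth f : smooth f -> mult0 f = 1%N.
Proof.
move=> [f0 f1]; apply: (@is_ord_pull1_mult0 None); split.
  by apply/eqP => /pull1_row_eq0 H; case: f1; rewrite H // eqxx.
case=> // _; apply/pull1_row_eq0 => i j /eqP; rewrite addn_eq0.
by move=> /andP[/eqP-> /eqP->].
Qed.

Lemma strict1_smooth_Some a f : smooth f ->
  strict1 (Some a) f 0%N 0%N = f 1%N 0%N + f 0%N 1%N * a /\
  strict1 (Some a) f 0%N 1%N = f 0%N 1%N.
Proof.
move=> sf; rewrite /strict1 mult0_smooth // /pull1 !big_ord_recl !big_ord0 /=.
rewrite (_ : bump 0 0 = 1%N) // !addr0; split.
  by rewrite !bin0 !mulr1; congr (_ + _); exact: mulr1.
by rewrite bin_small // mulr0 mul0r add0r binn mulr1; exact: mulr1.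
Qed.

Lemma strict1_smooth_None f : smooth f ->
  strict1 None f 0%N 0%N = f 0%N 1%N /\ strict1 None f 0%N 1%N = f 1%N 0%N.
Proof. by move=> sf; rewrite /strict1 mult0_smooth. Qed.

(** A class stable under strict transforms: a smooth curve stays smooth at one point of the
    exceptional curve and is empty at the others. *)
Definition smooth_or_unit f := smooth f \/ f 0%N 0%N != 0.

Lemma strict1_smooth_or_unit c f :
  smooth_or_unit f -> smooth_or_unit (strict1 c f).
Proof.
case=> [sf|f0]; last by right; apply: strict1_unit.
have [|?] := eqVneq (strict1 c f 0%N 0%N) 0; last by right.
case: (sf) => _ f1; move=> E; left; split=> //; right; case: c E => [a|].
  have [-> ->] := strict1_smooth_Some a sf; case: f1 => // f1.
  by apply: contra_eqN => /eqP ->; rewrite mul0r addr0.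
have [-> ->] := strict1_smooth_None sf => f01; case: f1 => //.
by rewrite f01 eqxx.
Qed.

(** The strict transform passes through the point of direction c exactly when the linear part of f
    vanishes on that line, and a nonzero linear form has a single zero line. *)
Lemma smooth_direction_unique c d f : smooth f ->
  strict1 c f 0%N 0%N = 0 -> strict1 d f 0%N 0%N = 0 -> c = d.
Proof.
move=> sf; case: (sf) => _ f1.
have [n1 _] := strict1_smooth_None sf.
case: c d => [a|] [b|] //; rewrite ?n1.
- have [-> _] := strict1_smooth_Some a sf; have [-> _] := strict1_smooth_Some b sf.
  move=> A B; have [f01|f01] := eqVneq (f 0%N 1%N) 0.
    by move: A f1; rewrite f01 mul0r addr0 => ->; rewrite eqxx => -[].
  by congr Some; apply: (mulfI f01); apply: (addrI (f 1%N 0%N)); rewrite A B.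
- have [-> _] := strict1_smooth_Some a sf => + f01; move: f1; rewrite f01.
  by rewrite mul0r addr0 eqxx => -[/eqP|].
- have [-> _] := strict1_smooth_Some b sf => f01; move: f1; rewrite f01.
  by rewrite mul0r addr0 eqxx => -[/eqP|].
Qed.

(** A common direction would be a nonzero common zero of two linear forms with nonzero
    determinant. *)
Lemma transversal_separate c f g : smooth f -> smooth g -> jacobian f g != 0 ->
  strict1 c f 0%N 0%N = 0 -> strict1 c g 0%N 0%N = 0 -> False.
Proof.
rewrite /jacobian => sf sg; case: c => [a|].
  have [-> _] := strict1_smooth_Some a sf; have [-> _] := strict1_smooth_Some a sg.
  move=> J /eqP; rewrite addr_eq0 => /eqP A /eqP; rewrite addr_eq0 => /eqP B.
  by case/eqP: J; rewrite A B; ring.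
have [-> _] := strict1_smooth_None sf; have [-> _] := strict1_smooth_None sg.
by move=> /eqP J f01 g01; case: J; rewrite f01 g01; ring.
Qed.

Lemma pull_cat s t f : pull (s ++ t) f = pull t (pull s f).
Proof. by elim: s f => //= c s IH f. Qed.

Lemma strict_cat s t f : strict (s ++ t) f = strict t (strict s f).
Proof. by elim: s f => //= c s IH f. Qed.

Lemma pullM t f g : pull t (f * g) = pull t f * pull t g.
Proof. by elim: t f g => //= c t IH f g; rewrite pull1M IH. Qed.

Lemma pullD t f g : pull t (f + g) = pull t f + pull t g.
Proof. by elim: t f g => //= c t IH f g; rewrite pull1D IH. Qed.

Lemma pull_1 t : pull t 1 = 1 :> series.
Proof. by elim: t => //= c t IH; rewrite pull1_1 IH. Qed.

Lemma pullX t f n : pull t (f ^+ n) = pull t f ^+ n.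
Proof. by elim: n => [|n IH]; rewrite ?expr0 ?pull_1 // !exprS pullM IH. Qed.

Lemma pull1_00 c f : pull1 c f 0%N 0%N = f 0%N 0%N.
Proof. by case: c => //= a; rewrite big_ord1 expr0 !mulr1. Qed.

Lemma pull_00 t f : pull t f 0%N 0%N = f 0%N 0%N.
Proof. by elim: t f => //= c t IH f; rewrite IH pull1_00. Qed.

Lemma strict_neq0 t f : f != 0 -> strict t f != 0.
Proof. by elim: t f => //= c t IH f f0; rewrite IH ?strict1_neq0. Qed.

Lemma strictM t f g : f != 0 -> g != 0 ->
  strict t (f * g) = strict t f * strict t g.
Proof.
by elim: t f g => //= c t IH f g f0 g0; rewrite strict1M // IH ?strict1_neq0.
Qed.

Lemma strict_unit t f : f 0%N 0%N != 0 -> strict t f 0%N 0%N != 0.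
Proof. by elim: t f => //= c t IH f f0; rewrite IH ?strict1_unit. Qed.

Lemma strict_smooth_or_unit t f :
  smooth_or_unit f -> smooth_or_unit (strict t f).
Proof. by elim: t f => //= c t IH f sf; apply/IH/strict1_smooth_or_unit. Qed.

Lemma strict_1 t : strict t 1 = 1 :> series.
Proof.
elim: t => //= c t IH; suff -> : strict1 c 1 = 1 :> series by [].
by apply: (proj2 (@strict1_unique _ _ 0 _ _ one_row0)); rewrite mul1r pull1_1.
Qed.

Lemma smooth_sx : smooth sx. Proof. by split=> //; left; rewrite oner_eq0. Qed.
Lemma smooth_sy : smooth sy. Proof. by split=> //; right; rewrite oner_eq0. Qed.

End Blowup.

(** * Convergence and Weierstrass division *)

Section Convergence.
Variable R : realType.
Local Notation C := R[i].
Local Notation series := (series R).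
Implicit Types f g h u v : series.

(** The order of [R[i]] is partial: the lower bounds 1 force M and r to be real, and allow the
    constants of two series to be merged by addition. *)
Definition bounded_by f (M r : C) :=
  [/\ 1 <= M, 1 <= r & forall i j, `|f i j| <= M * r ^+ (i + j)].

Lemma convergent_bounded f : convergent f <-> exists M r, bounded_by f M r.
Proof.
split=> [[M [r fMr]]|[M [r [_ _ H]]]]; last by exists M, r.
have M0 : 0 <= M by have := le_trans (normr_ge0 _) (fMr 0%N 0%N); rewrite mulr1.
(* If M = 0 nothing is known about r, which may be any complex number; otherwise the bound at (1, 0)
   shows that r is a nonnegative real. *)
exists (M + 1), (if M == 0 then 1 else r + 1).
have [E|Mn0] := eqVneq M 0.
  split; rewrite ?E ?add0r // => i j; rewrite expr1n mulr1.
  by apply: le_trans (fMr i j) _; rewrite E mul0r.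
have r0 : 0 <= r.
  have := le_trans (normr_ge0 _) (fMr 1%N 0%N); rewrite expr1 pmulr_rge0 //.
  by rewrite lt0r Mn0.
split; rewrite ?lerDr // => i j; apply: le_trans (fMr i j) _.
by rewrite ler_pM ?exprn_ge0 ?lerXn2r ?nnegrE ?addr_ge0 ?lerDl.
Qed.

Lemma bounded_by_le f M r M' r' : M <= M' -> r <= r' ->
  bounded_by f M r -> bounded_by f M' r'.
Proof.
move=> MM rr [M1 r1 H]; split; [exact: le_trans MM|exact: le_trans rr|] => i j.
have M0 := le_trans ler01 M1; have r0 := le_trans ler01 r1.
apply: le_trans (H i j) _; apply: ler_pM; rewrite ?exprn_ge0 //.
by rewrite lerXn2r ?nnegrE ?(le_trans r0).
Qed.

Lemma convergent_bounded2 f g : convergent f -> convergent g ->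
  exists M r, bounded_by f M r /\ bounded_by g M r.
Proof.
move=> /convergent_bounded[M [r fb]] /convergent_bounded[M' [r' gb]].
exists (M + M'), (r + r'); case: (fb) (gb) => [M1 r1 _] [M1' r1' _].
have [M0 r0] := (le_trans ler01 M1, le_trans ler01 r1).
have [M0' r0'] := (le_trans ler01 M1', le_trans ler01 r1').
by split; [apply: bounded_by_le fb|apply: bounded_by_le gb]; rewrite ?lerDl ?lerDr.
Qed.

Lemma natr_le_expr2 n : n.+1%:R <= 2 ^+ n :> C.
Proof. by rewrite -natrX ler_nat ltn_expl. Qed.

Lemma convergentD f g : convergent f -> convergent g -> convergent (f + g).
Proof.
move=> cf cg; have [M [r [[_ _ fb] [_ _ gb]]]] := convergent_bounded2 cf cg.
exists (M + M), r => i j; rewrite serDE mulrDl.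
by apply: le_trans (ler_normD _ _) _; rewrite lerD.
Qed.

Lemma convergentN f : convergent f -> convergent (- f).
Proof. by move=> [M [r H]]; exists M, r => i j; rewrite serNE normrN. Qed.

Lemma convergentB f g : convergent f -> convergent g -> convergent (f - g).
Proof. by move=> cf cg; apply/convergentD/convergentN. Qed.

Lemma convergentM f g : convergent f -> convergent g -> convergent (f * g).
Proof.
move=> cf cg; have [M [r [[M1 r1 fb] [_ _ gb]]]] := convergent_bounded2 cf cg.
have M0 := le_trans ler01 M1; have r0 := le_trans ler01 r1.
(* The factor 2 absorbs the number (n + 1)(k + 1) of products, at most 2^(n + k). *)
exists (M * M), (2 * r) => n k; rewrite serME.
apply: (@le_trans _ _ (\sum_(i < n.+1) \sum_(j < k.+1) M * M * r ^+ (n + k))).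
  apply: le_trans (ler_norm_sum _ _ _) _; apply: ler_sum => i _.
  apply: le_trans (ler_norm_sum _ _ _) _; apply: ler_sum => j _.
  rewrite normrM (le_trans (ler_pM _ _ (fb _ _) (gb _ _))) //.
  rewrite mulrACA -exprD le_eqVlt; apply/orP; left; apply/eqP.
  by congr (_ * _ ^+ _); have := leq_ord i; have := leq_ord j; lia.
rewrite !sumr_const !card_ord -mulrnA -[leLHS]mulr_natl exprMn natrM mulrCA.
rewrite ler_wpM2l ?mulr_ge0 // ler_wpM2r ?exprn_ge0 // addnC exprD.
by rewrite ler_pM ?natr_le_expr2.
Qed.

Lemma convergentC (f : series) (a : C) :
  (forall i j, (0 < i + j)%N -> f i j = 0) -> f 0%N 0%N = a -> convergent f.
Proof.
move=> f0 fa; exists `|a|, 1 => i j; rewrite expr1n mulr1.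
case: i j => [|i] [|j]; by rewrite ?fa // f0 ?normr0.
Qed.

Lemma convergent1 : convergent (1 : series).
Proof. by apply: convergentC erefl => -[|i] [|j]; rewrite -?soneE. Qed.

Lemma convergent0 : convergent (0 : series).
Proof. exact: convergentC erefl. Qed.

Lemma convergentX f n : convergent f -> convergent (f ^+ n).
Proof.
move=> cf; elim: n => [|n IH]; [exact: convergent1|].
by rewrite exprS; apply: convergentM.
Qed.

Lemma convergent_sx : convergent (sx : series).
Proof.
exists 1, 1 => i j; rewrite expr1n mulr1 /sx; case: (_ && _); rewrite ?normr1 //.
by rewrite normr0.
Qed.

Lemma convergent_swap f : convergent f -> convergent (swap f).
Proof. by move=> [M [r H]]; exists M, r => i j; rewrite addnC H. Qed.

Lemma convergent_sy : convergent (sy : series).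
Proof. exact/convergent_swap/convergent_sx. Qed.

Lemma convergent_shift m l f : convergent f ->
  convergent (fun i j => f (i + m)%N (j + l)%N).
Proof.
move=> [M [r H]]; exists (M * r ^+ (m + l)), r => i j.
by rewrite -mulrA -exprD (_ : (m + l + (i + j) = i + m + (j + l))%N) //; lia.
Qed.

Lemma convergent_pull1 c f : convergent f -> convergent (pull1 c f).
Proof.
have H a (g : series) : convergent g -> convergent (pull1 (Some a) g).
  move=> /convergent_bounded[M [r [M1 r1 gb]]].
  have M0 := le_trans ler01 M1; have r0 := le_trans ler01 r1.
  pose A := 1 + `|a|; have A1 : 1 <= A by rewrite lerDl.
  have A0 := le_trans ler01 A1.
  have B0 : 0 <= r * 2 * A by rewrite !mulr_ge0.
  (* Each of the n + 1 terms is at most M r^n 2^n A^n: the binomial coefficient is at most 2^n and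
     the power of a at most A^n. The outer 2 absorbs the number of terms. *)
  exists M, (2 * (r * 2 * A)) => n k; rewrite /pull1.
  apply: (@le_trans _ _ (\sum_(j < n.+1) M * (r * 2 * A) ^+ n)).
    apply: le_trans (ler_norm_sum _ _ _) _; apply: ler_sum => j _.
    rewrite !normrM normr_nat normrX !exprMn !mulrA.
    apply: ler_pM; rewrite ?mulr_ge0 ?exprn_ge0 //.
      apply: ler_pM; rewrite ?ler0n //.
        by have := gb (n - j)%N j; rewrite subnK // -ltnS.
      rewrite -natrX ler_nat; apply: (@leq_trans (2 ^ j)).
        have -> : (2 ^ j = \sum_(i < j.+1) 'C(j, i))%N.
          rewrite -[2%N]/(1 + 1)%N expnDn; apply: eq_bigr => i _.
          by rewrite !exp1n !muln1.
        case: (leqP k j) => kj; last by rewrite bin_small.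
        have kj' : (k < j.+1)%N by [].
        by rewrite (bigD1 (Ordinal kj')) //= leq_addr.
      by rewrite leq_exp2l // -ltnS.
    apply: (@le_trans _ _ (A ^+ (j - k))).
      by rewrite lerXn2r ?nnegrE // lerDr.
    by rewrite ler_weXn2l // (leq_trans (leq_subr _ _)) // -ltnS.
  rewrite sumr_const card_ord -[leLHS]mulr_natl mulrCA ler_wpM2l // [leRHS]exprMn.
  apply: ler_pM; rewrite ?ler0n ?exprn_ge0 //.
    by rewrite (le_trans (natr_le_expr2 n)) // ler_weXn2l ?ler1n // leq_addr.
  by rewrite ler_weXn2l ?leq_addr // !mulr_ege1 ?ler1n.
by case: c => [a|]; rewrite ?pull1_NoneE => cf; apply: H => //; apply: convergent_swap.
Qed.

Lemma convergent_strict1 c f : convergent f -> convergent (strict1 c f).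
Proof.
move=> /(convergent_pull1 c)/(convergent_shift (mult0 f) 0).
by congr convergent; apply/funext => i; apply/funext => j; rewrite addn0.
Qed.

Lemma convergent_pull t f : convergent f -> convergent (pull t f).
Proof. by elim: t f => //= c t IH f cf; apply/IH/convergent_pull1. Qed.

Lemma convergent_strict t f : convergent f -> convergent (strict t f).
Proof. by elim: t f => //= c t IH f cf; apply/IH/convergent_strict1. Qed.

End Convergence.

(** Course-of-values recursion: the value at n of the iterates of F is stable from step n + 1 on. *)
Lemma strong_recursion T (t0 : T) (F : (nat -> T) -> nat -> T) :
  (forall n g g', (forall i, (i < n)%N -> g i = g' i) -> F g n = F g' n) ->
  exists g, forall n, g n = F g n.
Proof.
move=> FP; pose G k := iter k F (fun=> t0).
have GS k n : (n < k)%N -> G k n = G k.+1 n.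
  elim: k n => // k IH n nk; apply: FP => i ni.
  by apply: IH; apply: leq_trans ni _.
have GE k n : (n < k)%N -> G k n = G n.+1 n.
  elim: k => // k IH; rewrite ltnS leq_eqVlt => /orP[/eqP -> //|nk].
  by rewrite -GS // IH.
by exists (fun n => G n.+1 n) => n; apply: FP => i ni; apply: GE.
Qed.

(** * Weierstrass division with a convergent quotient *)

Section Weierstrass.
Variable R : realType.
Local Notation C := R[i].
Local Notation series := (series R).
Implicit Types f g h u v : series.

Section Division.
Variables (f g : series) (d : nat).
Hypotheses (fd : f 0%N d != 0) (f0 : forall j, (j < d)%N -> f 0%N j = 0).

(** The equation between the coefficients of x^n y^(k + d) in q f and g, solved for [q n k]. In row
    n the terms with l > k are absent because they involve [f 0 j] with j < d. *)
Definition quotient_step (q : series) n k : C :=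
  (g n (k + d)%N
   - \sum_(i < n) \sum_(l < (k + d).+1) q i l * f (n - i)%N (k + d - l)%N
   - \sum_(l < k) q n l * f 0%N (k + d - l)%N) / f 0%N d.

(** The value [q n k] uses earlier rows up to column k + d, beyond k; so the recursion is
    lexicographic, over whole rows and then along each row. *)
Lemma quotient_step_fixpoint :
  exists q : series, forall n k, q n k = quotient_step q n k.
Proof.
have row (a : nat -> C) : {r : nat -> C | forall k, r k =
    (a k - \sum_(l < k) r l * f 0%N (k + d - l)%N) / f 0%N d}.
  apply: cid; apply: (strong_recursion 0) => k r r' rr; congr ((_ - _) / _).
  by apply: eq_bigr => l _; rewrite rr.
pose a (q : series) n k := g n (k + d)%N
   - \sum_(i < n) \sum_(l < (k + d).+1) q i l * f (n - i)%N (k + d - l)%N.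
have [|q qE] := @strong_recursion (nat -> C) (fun=> 0)
  (fun q n => sval (row (a q n))).
  move=> n q q' qq; suff -> : a q n = a q' n by [].
  apply/funext => k; congr (_ - _); apply: eq_bigr => i _; apply: eq_bigr => l _.
  by rewrite qq.
by exists q => n k; rewrite qE (svalP (row (a q n)) k) -qE.
Qed.

Lemma quotient_stepP (q : series) : (forall n k, q n k = quotient_step q n k) ->
  forall n k, (q * f) n (k + d)%N = g n (k + d)%N.
Proof.
move=> qE n k; rewrite serME big_ord_recr /= subnn.
have -> : \sum_(l < (k + d).+1) q n l * f 0%N (k + d - l)%N =
    \sum_(l < k) q n l * f 0%N (k + d - l)%N + q n k * f 0%N d.
  rewrite -(big_mkord xpredT (fun l => q n l * f 0%N (k + d - l)%N)).
  rewrite (big_cat_nat (n := k)) ?leqW ?leq_addr //= big_mkord; congr (_ + _).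
  rewrite big_ltn ?ltnS ?leq_addr // addKn big_nat big1 ?addr0 // => l /andP[kl lk].
  by rewrite f0 ?mulr0 //; lia.
by rewrite (qE n k) /quotient_step divfK //; ring.
Qed.

Lemma quotient_convergent (q : series) :
  convergent f -> convergent g -> (forall n k, q n k = quotient_step q n k) ->
  convergent q.
Proof.
move=> cf cg qE; have [B [r [[B1 r1 fb] [_ _ gb]]]] := convergent_bounded2 cf cg.
have r0 := lt_le_trans ltr01 r1.
(* The bound to prove by induction is al b^n a^k r^(n + k). With al = 3 H / e, each of the three
   terms of [quotient_step] may use a third of it. The choice a = 1 + al gives geometric sums at
   most a^k / al along a row; sums reaching column k + d cost an extra a^(d + 1), which is the value
   of be, and b = 1 + be gains 1 / be in the sum over the rows. *)
pose H := B * r ^+ d; pose e := `|f 0%N d|.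
have e0 : 0 < e by rewrite normr_gt0.
have H0 : 0 < H by rewrite mulr_gt0 ?exprn_gt0 // (lt_le_trans ltr01 B1).
pose al := 3 * H / e; have al0 : 0 < al by rewrite divr_gt0 ?e0 // mulr_gt0 // ltr0n.
pose a := 1 + al; pose be := a ^+ d.+1; pose b := 1 + be.
have a1 : 1 <= a by rewrite lerDl ltW.
have a0 := lt_le_trans ltr01 a1.
have be0 : 0 < be by rewrite exprn_gt0.
have b1 : 1 <= b by rewrite lerDl ltW.
have b0 := lt_le_trans ltr01 b1.
have geom (c x : C) k : 0 < c -> x = 1 + c -> \sum_(l < k) x ^+ l <= x ^+ k / c.
  move=> c0 xE; rewrite ler_pdivlMr // mulrC.
  have -> : c = x - 1 by rewrite xE addrC addKr.
  by rewrite -subrX1 lerBlDr lerDl.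
have M0 := ltW al0.
have key n k : `|q n k| <= al * (b ^+ n * a ^+ k) * r ^+ (n + k).
  elim/ltn_ind: n k => n IHn k; elim/ltn_ind: k => k IHk.
  rewrite qE /quotient_step normrM normfV ler_pdivrMr //.
  apply: le_trans (ler_normB _ _) _; apply: le_trans (lerD (ler_normB _ _) (lexx _)) _.
  pose U := \sum_(l < (k + d).+1) a ^+ l; pose V := \sum_(i < n) b ^+ i.
  pose S := \sum_(l < k) a ^+ l.
  have T1 : `|g n (k + d)%N| <= r ^+ (n + k) * H.
    by apply: le_trans (gb _ _) _; rewrite addnA exprD mulrCA.
  have T2 : `|\sum_(i < n) \sum_(l < (k + d).+1) q i l * f (n - i)%N (k + d - l)%N|
      <= r ^+ (n + k) * H * (al * V * U).
    rewrite /V [al * _]mulr_sumr mulr_suml [leRHS]mulr_sumr.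
    apply: le_trans (ler_norm_sum _ _ _) _; apply: ler_sum => i _.
    rewrite /U !mulr_sumr.
    apply: le_trans (ler_norm_sum _ _ _) _; apply: ler_sum => l _.
    rewrite normrM (le_trans (ler_pM _ _ (IHn i _ l) (fb _ _))) //.
    rewrite le_eqVlt; apply/orP; left; apply/eqP.
    have -> : r ^+ (n + k) * H = B * (r ^+ (i + l) * r ^+ (n - i + (k + d - l))).
      rewrite mulrCA -!exprD; congr (_ * _ ^+ _).
      by move: (ltn_ord i) (leq_ord l); clear; lia.
    by ring.
  have T3 : `|\sum_(l < k) q n l * f 0%N (k + d - l)%N|
      <= r ^+ (n + k) * H * (al * b ^+ n * S).
    rewrite /S !mulr_sumr.
    apply: le_trans (ler_norm_sum _ _ _) _; apply: ler_sum => l _.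
    rewrite normrM (le_trans (ler_pM _ _ (IHk l _) (fb _ _))) //.
    rewrite le_eqVlt; apply/orP; left; apply/eqP.
    have -> : r ^+ (n + k) * H = B * (r ^+ (n + l) * r ^+ (0 + (k + d - l))).
      rewrite mulrCA -!exprD; congr (_ * _ ^+ _).
      by move: (ltn_ord l); clear; lia.
    by ring.
  apply: le_trans (lerD (lerD T1 T2) T3) _.
  rewrite -[X in X + _ + _]mulr1 -!mulrDr [leRHS]mulrAC [leRHS]mulrC -[leLHS]mulrA.
  rewrite ler_pM2l ?exprn_gt0 //.
  have -> : al * (b ^+ n * a ^+ k) * e = H * (3 * (b ^+ n * a ^+ k)).
    by rewrite /al; field; rewrite gt_eqF.
  rewrite ler_pM2l //.
  have W1 : 1 <= b ^+ n * a ^+ k by rewrite mulr_ege1 ?exprn_ege1.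
  have W2 : al * V * U <= b ^+ n * a ^+ k.
    have V0 : 0 <= V by apply: sumr_ge0 => i _; rewrite exprn_ge0 ?ltW.
    have U0 : 0 <= U by apply: sumr_ge0 => i _; rewrite exprn_ge0 ?ltW.
    have VU := ler_pM V0 U0 (geom be b n be0 erefl) (geom al a _ al0 erefl).
    rewrite -mulrA; apply: le_trans (ler_wpM2l M0 VU) _.
    rewrite -addnS exprD -/be le_eqVlt; apply/orP; left; apply/eqP.
    by field; rewrite !gt_eqF.
  have W3 : al * b ^+ n * S <= b ^+ n * a ^+ k.
    have M0' : 0 <= al * b ^+ n by rewrite mulr_ge0 ?exprn_ge0 ?ltW.
    apply: le_trans (ler_wpM2l M0' (geom al a k al0 erefl)) _.
    rewrite le_eqVlt; apply/orP; left; apply/eqP.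
    by field; rewrite gt_eqF.
  have -> : 3 * (b ^+ n * a ^+ k) =
    b ^+ n * a ^+ k + b ^+ n * a ^+ k + b ^+ n * a ^+ k by ring.
  by rewrite !lerD.
exists al, (b * a * r) => n k; apply: le_trans (key n k) _.
rewrite -mulrA ler_pM2l // [(b * a * r) ^+ _]exprMn ler_pM2r ?exprn_gt0 //.
rewrite exprMn; apply: ler_pM.
- by rewrite exprn_ge0 ?ltW.
- by rewrite exprn_ge0 ?ltW.
- by rewrite ler_weXn2l ?leq_addr.
- by rewrite ler_weXn2l ?leq_addl.
Qed.

End Division.

Lemma weierstrass_division f g d : convergent f -> convergent g ->
  f 0%N d != 0 -> (forall j, (j < d)%N -> f 0%N j = 0) ->
  exists q, convergent q /\
    forall n k, (d <= k)%N -> (g - q * f) n k = 0.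
Proof.
move=> cf cg fd f0; have [q qE] := quotient_step_fixpoint f g d.
exists q; split; first exact: quotient_convergent qE.
move=> n k dk; rewrite serDE serNE -(subnK dk) (quotient_stepP fd f0 qE).
by rewrite subrr.
Qed.

(** Dividing 1 by a series that is regular of order 0 in y leaves no remainder. *)
Lemma convergent_inverse f : convergent f -> f 0%N 0%N != 0 ->
  exists g, [/\ convergent g, g * f = 1 & g 0%N 0%N != 0].
Proof.
move=> cf f0; have [|q [cq E]] := weierstrass_division cf (@convergent1 R) f0.
  by [].
exists q; have qf : q * f = 1.
  apply/esym/eqP; rewrite -subr_eq0; apply/eqP/funext => n; apply/funext => k.
  exact: E.
split=> //; have : (q * f) 0%N 0%N != 0 by rewrite qf -soneE oner_eq0.
by apply: contraNneq => q0; rewrite serME !big_ord1 q0 mul0r.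
Qed.

End Weierstrass.

(** * Divisibility of convergent series *)

Section Divisibility.
Variable R : realType.
Local Notation C := R[i].
Local Notation series := (series R).
Implicit Types e f g h l u v : series.

Definition sunit e := convergent e /\ e 0%N 0%N != 0.

Lemma sunit1 : sunit 1.
Proof. by split; [exact: convergent1|rewrite -soneE oner_eq0]. Qed.

Lemma sunitM e g : sunit e -> sunit g -> sunit (e * g).
Proof.
move=> [ce e0] [cg g0]; split; first exact: convergentM.
by rewrite serME !big_ord1 mulf_neq0.
Qed.

Lemma sunit_inv e : sunit e -> exists2 g, sunit g & g * e = 1.
Proof.
by move=> [ce e0]; have [g [cg ge g0]] := convergent_inverse ce e0; exists g.
Qed.

Lemma sdvdP f g : sdvd f g <-> exists2 h, convergent h & g = f * h.
Proof.
by split=> [[h [ch]]|[h ch ->]]; [rewrite smulE; exists h|exists h; rewrite smulE].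
Qed.

Lemma sdvd_refl f : sdvd f f.
Proof. by apply/sdvdP; exists 1; rewrite ?mulr1 //; apply: convergent1. Qed.

Lemma sdvd0 f : sdvd f 0.
Proof. by apply/sdvdP; exists 0; rewrite ?mulr0 //; apply: convergent0. Qed.

Lemma sdvd_trans g f h : sdvd f g -> sdvd g h -> sdvd f h.
Proof.
move=> /sdvdP[a ca ->] /sdvdP[b cb ->]; apply/sdvdP; exists (a * b); rewrite ?mulrA //.
exact: convergentM.
Qed.

Lemma sdvd_mulr f g h : convergent h -> sdvd f g -> sdvd f (g * h).
Proof.
move=> ch /sdvdP[a ca ->]; apply/sdvdP; exists (a * h); rewrite ?mulrA //.
exact: convergentM.
Qed.

Lemma sdvd_mull f g h : convergent h -> sdvd f g -> sdvd f (h * g).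
Proof. by rewrite mulrC; apply: sdvd_mulr. Qed.

Lemma sdvdD f g h : sdvd f g -> sdvd f h -> sdvd f (g + h).
Proof.
move=> /sdvdP[a ca ->] /sdvdP[b cb ->]; apply/sdvdP; exists (a + b); rewrite ?mulrDr //.
exact: convergentD.
Qed.

Lemma sdvdN f g : sdvd f g -> sdvd f (- g).
Proof.
move=> /sdvdP[a ca ->]; apply/sdvdP; exists (- a); rewrite ?mulrN //.
exact: convergentN.
Qed.

Lemma sdvdB f g h : sdvd f g -> sdvd f h -> sdvd f (g - h).
Proof. by move=> fg fh; apply/sdvdD/sdvdN. Qed.

Lemma sdvd_00 f g : sdvd f g -> f 0%N 0%N = 0 -> g 0%N 0%N = 0.
Proof. by move=> /sdvdP[h _ ->] f0; rewrite serME !big_ord1 f0 mul0r. Qed.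

Lemma sdvd_unit f e : f 0%N 0%N = 0 -> sunit e -> ~ sdvd f e.
Proof. by move=> f0 [_ /eqP e0] /sdvd_00 /(_ f0). Qed.

Lemma sdvd_swap f g : sdvd f g -> sdvd (swap f) (swap g).
Proof.
move=> /sdvdP[h ch ->]; rewrite swapM; apply/sdvdP; exists (swap h) => //.
exact: convergent_swap.
Qed.

Lemma sdvd_unit_mul f g e : sunit e -> sdvd f (e * g) -> sdvd f g.
Proof.
move=> /sunit_inv[e' [ce' _] e'e] fg.
by rewrite -[g]mul1r -e'e -mulrA; apply: sdvd_mull.
Qed.

Definition sprime v :=
  forall f g, convergent f -> convergent g -> sdvd v (f * g) ->
    sdvd v f \/ sdvd v g.

Lemma sprimeX v f n : sprime v -> convergent f -> v 0%N 0%N = 0 ->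
  sdvd v (f ^+ n) -> sdvd v f.
Proof.
move=> pv cf v0; elim: n => [|n IH].
  by rewrite expr0 => /(sdvd_unit v0 sunit1).
by rewrite exprS => /pv [//|//|//|]; [exact: convergentX|exact: IH].
Qed.

(** Up to exchanging coordinates, v is regular of order 1 in y, so the remainders of f and g modulo
    v depend on x only, and so does their product, a multiple of v. If it were nonzero, its lowest
    row would be a multiple of the row 0 of v, hence without constant term, although it is a nonzero
    constant. So one remainder vanishes. *)
Lemma smooth_prime v : convergent v -> smooth v -> sprime v.
Proof.
have H (w : series) : convergent w -> w 0%N 0%N = 0 -> w 0%N 1%N != 0 -> sprime w.
  move=> cw w0 w1 f g cf cg /sdvdP[h ch wh].
  have wj j : (j < 1)%N -> w 0%N j = 0 by case: j.
  have [q [cq qE]] := weierstrass_division cw cf w1 wj.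
  have [q' [cq' qE']] := weierstrass_division cw cg w1 wj.
  pose r := f - q * w; pose r' := g - q' * w.
  have rr : r * r' = w * (h - f * q' - q * g + q * q' * w).
    rewrite !mulrDr !mulrN -wh /r /r'; ring.
  have rr0 n k : (1 <= k)%N -> (r * r') n k = 0.
    move=> k1; rewrite serME big1 // => i _; rewrite big1 // => -[[|j] jk] _ /=.
      by rewrite subn0 [r' _ _]qE' ?mulr0.
    by rewrite [r _ _]qE ?mul0r.
  have : r * r' = 0.
    apply: contrapT => /eqP nz; have [n on] := @is_ord_ex (ps C) _ nz.
    case: (on) => /eqP rn _; apply: rn; apply/funext => -[|k]; last exact: rr0.
    have wn0 : (w : ps (ps C)) 0%N != 0.
      by apply: contraNneq w1 => /(congr1 (fun z : ps C => z 1%N)) ->.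
    have ow : is_ord (w : ps (ps C)) 0 by [].
    set z := (h - _ - _ + _) in rr.
    have z0 : z != 0 by apply: contraNneq nz => z0; rewrite rr z0 mulr0.
    have [m om] := @is_ord_ex (ps C) _ z0.
    have mn : (0 + m)%N = n.
      apply: is_ord_uniq (is_ordM (@row_no_zero_divisors R) ow om) _.
      by rewrite -[_ * _]rr.
    rewrite rr serME big1 // => i _; rewrite big_ord1 /=.
    case: (posnP i) => [->|i0]; first by rewrite w0 mul0r.
    by rewrite (proj2 om) ?mulr0 //; move: mn i0 (leq_ord i); clear; lia.
  move=> /series_no_zero_divisors [] E; [left|right]; apply/sdvdP.
    by exists q => //; apply/eqP; rewrite mulrC -subr_eq0 -/r E.
  by exists q' => //; apply/eqP; rewrite mulrC -subr_eq0 -/r' E.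
move=> cv [v0 [v1|v1]]; last exact: H.
move=> f g cf cg /sdvd_swap; rewrite swapM => /(H (swap v)).
by case=> //; try exact: convergent_swap; move=> /sdvd_swap; [left|right].
Qed.

Lemma serM_10 f g : (f * g) 1%N 0%N =
  f 0%N 0%N * g 1%N 0%N + f 1%N 0%N * g 0%N 0%N.
Proof. by rewrite serME big_ord_recl !big_ord1. Qed.

Lemma serM_01 f g : (f * g) 0%N 1%N =
  f 0%N 0%N * g 0%N 1%N + f 0%N 1%N * g 0%N 0%N.
Proof. by rewrite serME big_ord1 big_ord_recl big_ord1. Qed.

(** A product of two vanishing series has no linear part. *)
Lemma smooth_irreducible v : convergent v -> smooth v -> irreducible v.
Proof.
move=> cv [v0 v1]; split=> // g h _ _; rewrite smulE => E.
apply: contrapT => /not_orP[/contrapT g0 /contrapT h0].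
move: v1; rewrite E serM_10 serM_01 g0 h0 !mulr0 !mul0r addr0 eqxx.
by case.
Qed.

Lemma associatesP f g : associates f g <-> exists2 e, sunit e & f = e * g.
Proof.
split=> [[e [ce e0]]|[e [ce e0] ->]].
  by rewrite smulE; exists e => //; split=> //; apply/eqP.
by exists e; rewrite smulE; split=> //; apply/eqP.
Qed.

Lemma irreducible_sdvd l u : irreducible l -> irreducible u -> sdvd l u ->
  exists2 e, sunit e & u = e * l.
Proof.
move=> [cl l0 _] [_ _ H] /sdvdP[h ch E]; exists h; last by rewrite mulrC.
have /(H l h cl ch) : u = smul l h by rewrite smulE.
by case=> [/(_ l0) //|/eqP].
Qed.

Lemma irreducible_sdvd_sym l u : irreducible l -> irreducible u -> sdvd l u ->
  sdvd u l.
Proof.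
move=> il iu /(irreducible_sdvd il iu) [e ue ->].
by apply: (sdvd_unit_mul ue); apply: sdvd_refl.
Qed.

Lemma smooth_sdvd u v : convergent u -> smooth u -> convergent v -> smooth v ->
  sdvd u v -> exists2 e, sunit e & v = e * u.
Proof.
by move=> cu su cv sv; apply: irreducible_sdvd; apply: smooth_irreducible.
Qed.

Lemma sx_irreducible : irreducible (sx : series).
Proof. exact/smooth_irreducible/smooth_sx/convergent_sx. Qed.

Lemma sy_irreducible : irreducible (sy : series).
Proof. exact/smooth_irreducible/smooth_sy/convergent_sy. Qed.

Lemma sx_prime : sprime sx.
Proof. exact/smooth_prime/smooth_sx/convergent_sx. Qed.

Lemma sy_prime : sprime sy.
Proof. exact/smooth_prime/smooth_sy/convergent_sy. Qed.

Lemma jacobian_unit e e' f g : sunit e -> sunit e' ->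
  f 0%N 0%N = 0 -> g 0%N 0%N = 0 ->
  jacobian f g != 0 -> jacobian (e * f) (e' * g) != 0.
Proof.
move=> [_ e0] [_ e0'] f0 g0 J.
rewrite /jacobian !serM_10 !serM_01 f0 g0 !mulr0 !addr0.
rewrite (_ : _ - _ = e 0%N 0%N * e' 0%N 0%N * jacobian f g); last first.
  by rewrite /jacobian; ring.
by rewrite !mulf_neq0.
Qed.

Lemma jacobian_ndvd f g : f 0%N 0%N = 0 -> jacobian f g != 0 -> ~ sdvd f g.
Proof.
move=> f0 /eqP J /sdvdP[h _ E]; apply: J.
by rewrite /jacobian E serM_10 serM_01 f0 !mul0r !add0r; ring.
Qed.

End Divisibility.

(** * Reducedness of strict transforms *)

Section Derivation.
Variable B : comNzRingType.

Definition psderiv (f : ps B) : ps B := fun n => f n.+1 *+ n.+1.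

Lemma psderivM f g : psderiv (f * g) = psderiv f * g + f * psderiv g.
Proof.
apply/funext => n; rewrite psDE !psME /psderiv psME.
pose F i := f i * g (n.+1 - i)%N.
rewrite -sumrMnl (eq_bigr (fun i : 'I_n.+2 => F i *+ i + F i *+ (n.+1 - i))).
  rewrite big_split /=.
  congr (_ + _).
    rewrite big_ord_recl mulr0n add0r; apply: eq_bigr => i _.
    by rewrite /F /= /bump /= subSS mulrnAl.
  rewrite big_ord_recr /= subnn mulr0n addr0; apply: eq_bigr => i _.
  by rewrite /F subSn ?leq_ord // mulrnAr.
by move=> i _; rewrite -mulrnDr subnKC ?leq_ord.
Qed.

End Derivation.

Section Reducedness.
Variable R : realType.
Local Notation C := R[i].
Local Notation series := (series R).
Implicit Types e f g h l u v : series.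

Definition dx f : series := fun n k => f n.+1 k *+ n.+1.
Definition dy f : series := swap (dx (swap f)).

Lemma psMnE (B : comNzRingType) (r : ps B) n k : (r *+ n) k = r k *+ n.
Proof. by elim: n => // n IH; rewrite !mulrS psDE IH. Qed.

Lemma dxM f g : dx (f * g) = dx f * g + f * dx g.
Proof.
have E (h : series) : dx h = psderiv (h : ps (ps C)).
  by apply/funext => n; apply/funext => k; rewrite /psderiv psMnE.
by rewrite !E psderivM.
Qed.

Lemma dyM f g : dy (f * g) = dy f * g + f * dy g.
Proof.
rewrite /dy swapM dxM.
transitivity (swap (dx (swap f) * swap g) + swap (swap f * dx (swap g))) => //.
by rewrite 2!swapM.
Qed.

Lemma convergent_dx f : convergent f -> convergent (dx f).
Proof.
move=> /convergent_bounded[M [r [M1 r1 fb]]].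
have M0 := le_trans ler01 M1; have r0 := le_trans ler01 r1.
exists (M * r), (2 * r) => n k; rewrite /dx -[f _ _ *+ _]mulr_natr normrM normr_nat.
apply: le_trans (ler_pM _ _ (fb _ _) (natr_le_expr2 R n)) _ => //.
have -> : M * r ^+ (n.+1 + k) * 2 ^+ n = M * r * (2 ^+ n * r ^+ (n + k)).
  by rewrite addSn exprS; ring.
rewrite exprMn ler_wpM2l ?mulr_ge0 //.
by rewrite ler_wpM2r ?exprn_ge0 // ler_weXn2l ?ler1n // leq_addr.
Qed.

Lemma convergent_dy f : convergent f -> convergent (dy f).
Proof. by move=> cf; apply/convergent_swap/convergent_dx/convergent_swap. Qed.

(** This is y + a, the pullback of y in the chart [Some a] divided by x. *)
Definition affine (a : C) : series := sy + (fun i j => a * (1 : series) i j).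

Lemma convergent_affine a : convergent (affine a).
Proof.
apply: convergentD; first exact: convergent_sy.
apply: (@convergentC _ _ a) => [[|i] [|j]|]; rewrite -?soneE /sone ?mulr0 //.
by rewrite mulr1.
Qed.

Lemma affineM a f n k : (affine a * f) n k =
  a * f n k + if k is k'.+1 then f n k' else 0.
Proof.
rewrite mulrDl serDE addrC; congr (_ + _).
  rewrite serME big_ord_recl big_ord_recl /= -soneE mulr1 !subn0 big1 ?addr0.
    rewrite big1 ?addr0 // => i _; rewrite big1 // => j _.
    by rewrite /sone /= mulr0 mul0r.
  by move=> j _; rewrite /sone /= mulr0 mul0r.
have -> : (sy * f) = swap (sx * swap f) by rewrite swapM.
by rewrite /swap -[sx]expr1 sxME; case: k => // k; rewrite subn1.
Qed.

(** Chain rule for F(x, y) = f(x, x (y + a)): F_y is x times the pullback of f_y, and F_x is the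
    pullback of f_x plus y + a times that of f_y. *)
Lemma dy_pull1 a f : dy (pull1 (Some a) f) = sx * pull1 (Some a) (dy f).
Proof.
apply/funext => n; apply/funext => k; rewrite -[sx]expr1 sxME /dy /swap /dx.
rewrite !pull1_SomeE -coef_deriv deriv_comp derivD derivX derivC addr0 mulr1.
case: n => [|n]; rewrite /= ?subn1 /=.
  suff -> : homog 0 f = (f 0%N 0%N)%:P by rewrite derivC comp_poly0 coef0.
  by apply/polyP => -[|j]; rewrite coef_poly coefC.
congr ((_ \Po _)`_k); apply/polyP => j; rewrite coef_deriv !coef_poly ltnS subSS.
by case: ifP; rewrite ?mul0rn.
Qed.

Lemma dx_pull1 a f : dx (pull1 (Some a) f) =
  pull1 (Some a) (dx f) + affine a * pull1 (Some a) (dy f).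
Proof.
apply/funext => n; apply/funext => k; rewrite serDE affineM /dx !pull1_SomeE.
rewrite -coefMn -rmorphMn /=.
(* Euler's relation for the part of degree n + 1, at x = 1. *)
have -> : homog n.+1 f *+ n.+1 = homog n (dx f) + 'X * homog n (dy f).
  apply/polyP => j; rewrite coefMn coefD coefXM !coef_poly /dx /dy /swap /=.
  case: j => [|j] /=; first by rewrite addr0 !subn0.
  rewrite !ltnS subSS /dx; case: (ltngtP j n) => [jn|//|->].
  - have E : (n - j.+1).+1 = (n - j)%N by lia.
    by rewrite E -mulrnDr; congr (_ *+ _); lia.
  - by move=> _; rewrite mul0rn addr0.
  - by rewrite add0r.
rewrite rmorphD rmorphM /= comp_polyX mulrDl !coefD coefCM coefXM.
congr (_ + _); rewrite [LHS]addrC; congr (_ + _).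
by case: k => [|k] //; rewrite -pull1_SomeE.
Qed.

(** A double zero along v is a zero of the derivatives upstairs; the chain rule carries this down
    one blowup at a time. The factor x that it produces can be cancelled because v is assumed not to
    be exceptional. *)
Lemma sdvd_derivatives Q v f : convergent v -> smooth v -> convergent f ->
  (forall s c t, Q = s ++ c :: t -> ~ sdvd v (pull t sx)) ->
  sdvd (v * v) (pull Q f) ->
  sdvd v (pull Q (dx f)) /\ sdvd v (pull Q (dy f)).
Proof.
move=> cv sv; have pv := smooth_prime cv sv.
elim: Q f => [|c t IH] f cf exc /= .
  move=> /sdvdP[h ch ->]; rewrite -mulrA dxM dyM; split; apply: sdvdD.
  - by apply: sdvd_mull; [exact: convergent_dx|apply: sdvd_mulr (sdvd_refl _)].
  - by apply: sdvd_mulr (sdvd_refl _); apply/convergent_dx/convergentM.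
  - by apply: sdvd_mull; [exact: convergent_dy|apply: sdvd_mulr (sdvd_refl _)].
  - by apply: sdvd_mulr (sdvd_refl _); apply/convergent_dy/convergentM.
have [cfx cfy] := (convergent_dx cf, convergent_dy cf).
have ct := @convergent_pull R t; have c1 := @convergent_pull1 R.
have exc0 := exc [::] c t erefl.
have H a g : convergent g -> sdvd (v * v) (pull t (pull1 (Some a) g)) ->
    sdvd v (pull t (pull1 (Some a) (dx g))) /\
    sdvd v (pull t (pull1 (Some a) (dy g))).
  move=> cg /IH []; rewrite ?dx_pull1 ?dy_pull1; first exact: c1.
    by move=> s d t' E; apply: (exc (c :: s) d t'); rewrite E.
  rewrite pullM => dX /pv [||//|dY]; first exact/ct/convergent_sx.
    exact/ct/c1/convergent_dy.
  split=> //; move: dX; rewrite pullD pullM.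
  set p := pull _ _; set q := _ * _ => dX; rewrite -[p](addrK q).
  apply: sdvdB dX _; apply: sdvd_mull dY; exact/ct/convergent_affine.
case: c {exc exc0} => [a|]; first exact: H.
rewrite !pull1_NoneE => /H []; first exact: convergent_swap.
by move=> A B; split; [exact: B|exact: A].
Qed.

(** In the first chart one of x and y pulls back to the exceptional curve, which v does not
    divide. *)
Lemma pull_sx_nondividing v s : convergent v -> smooth v -> s != [::] ->
  (forall s' c t, s = s' ++ c :: t -> ~ sdvd v (pull t sx)) ->
  sdvd v (pull s sx) -> ~ sdvd v (pull s sy).
Proof.
move=> cv sv; case: s => // c t _ /(_ [::] c t erefl) /= exc.
by case: c => [a|]; rewrite ?pull1_sx ?pull1_None_sy.
Qed.

(* The convergent series whose pullback vanishes on the curve v form a prime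
   ideal. When it does not contain x, its y-regular elements of least order
   generate it by Weierstrass division, and the y-derivative of a generator has
   a smaller order; hence a double zero along v forces a square factor. *)
Lemma reduced_pull_squarefree Q v f : convergent v -> smooth v ->
  reduced_curve f -> Q != [::] ->
  (forall s c t, Q = s ++ c :: t -> ~ sdvd v (pull t sx)) ->
  ~ sdvd (v * v) (pull Q f).
Proof.
move=> cv sv [cf f00 fred] Q0 exc dvv.
have pv := smooth_prime cv sv; have [v0 _] := sv.
have cp := @convergent_pull R Q.
have nosq g : convergent g -> g 0%N 0%N = 0 -> ~ sdvd (g * g) f.
  by move=> cg g0; rewrite -smulE => /fred; apply.
have f0 : f != 0.
  apply/eqP => E; apply: (nosq sx (@convergent_sx R)) => //.
  by rewrite E; apply: sdvd0.
pose I g := sdvd v (pull Q g).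
have Ip g h : convergent g -> convergent h -> I (g * h) -> I g \/ I h.
  by move=> cg ch; rewrite /I pullM => /pv; apply; apply: cp.
have If : I f.
  by apply: sdvd_trans dvv; apply: sdvd_mulr (sdvd_refl _).
have I1 e : sunit e -> ~ I e.
  move=> [ce e0]; apply: sdvd_unit => //; split; first exact: cp.
  by rewrite pull_00.
have [Ifx Ify] := sdvd_derivatives cv sv cf exc dvv.
(* If x lies in the ideal I, then x generates it: an element is x times a series plus a series c in
   y alone, and a nonzero c would be a power of y times a unit, outside I. Writing f = x h, the
   derivative h + x h_x in I puts h in I, so x^2 divides f. *)
have [Ix|Ix] := pselect (I sx).
  have Iy : ~ I sy := pull_sx_nondividing cv sv Q0 exc Ix.
  have factor g : convergent g -> I g -> sdvd sx g.
    move=> cg Ig; pose c : series := fun i j => if i == 0%N then g 0%N j else 0.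
    have cc : convergent c.
      have [M [r gb]] := cg; exists M, r => -[|i] j; rewrite /c //=.
      by rewrite normr0; apply: le_trans (gb _ _).
    have gE : g = sx * (fun i j => g (i + 1)%N j) + c.
      apply/funext => i; apply/funext => j; rewrite serDE -[sx]expr1 sxME /c.
      by case: i => [|i]; rewrite /= ?add0r // subn1 addn1 addr0.
    have cs : convergent (fun i j => g (i + 1)%N j).
      have := convergent_shift 1 0 cg; congr convergent.
      by apply/funext => i; apply/funext => j; rewrite addn0.
    have Ic : I c.
      rewrite /I -(addKr (pull Q (sx * (fun i j => g (i + 1)%N j))) (pull Q c)).
      rewrite -pullD -gE addrC; apply: sdvdB => //; rewrite pullM.
      by apply: sdvd_mulr Ix; apply: cp.
    suff c0 : c = 0 by rewrite gE c0 addr0; apply: sdvd_mulr (sdvd_refl _).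
    apply: contrapT => /eqP c0.
    have sc0 : (swap c : ps (ps C)) != 0.
      by apply: contraNneq c0 => sc0; rewrite -[c]swapK sc0.
    have [n [cn0 cn]] := is_ord_ex sc0.
    have [w [cw wE w0]] : exists w,
        [/\ convergent w, swap c = sx ^+ n * w & w 0%N 0%N != 0].
      exists (fun i j => swap c (i + n)%N j); split.
      - have := convergent_shift n 0 (convergent_swap cc); congr convergent.
        by apply/funext => i; apply/funext => j; rewrite addn0.
      - by apply: shift_row => i j /cn ->.
      - apply: contraNneq cn0; rewrite add0n => cn00; apply/eqP/funext => -[|j] //.
    have := Ic; rewrite -[c]swapK wE swapM => /Ip.
    have -> : swap (sx ^+ n) = sy ^+ n :> series.
      by elim: (n) => [|m IH]; rewrite ?expr0 ?swap1 // !exprS swapM IH.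
    case; [exact/convergentX/convergent_sy|exact: convergent_swap| |].
      by rewrite /I pullX => /(sprimeX pv (cp _ (@convergent_sy R)) v0).
    by apply: I1; split=> //; apply: convergent_swap.
  have /sdvdP[h ch fE] := factor f cf If.
  have : I h.
    rewrite /I; have := Ifx; rewrite fE dxM.
    have -> : dx sx = 1 :> series.
      apply/funext => i; apply/funext => j; rewrite /dx /sx -soneE /sone.
      by case: i => [|i] //=; rewrite mul0rn.
    rewrite mul1r pullD pullM => dh.
    rewrite -(addrK (pull Q sx * pull Q (dx h)) (pull Q h)).
    apply: sdvdB dh _; apply: sdvd_mulr Ix; exact/cp/convergent_dx.
  move=> /(factor h ch)/sdvdP[h' ch' hE].
  apply: (nosq sx (@convergent_sx R)) => //; apply/sdvdP; exists h' => //.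
  by rewrite fE hE mulrA.
pose regular g d := g 0%N d != 0 /\ forall j, (j < d)%N -> g 0%N j = 0.
pose P d := exists g, [/\ convergent g, I g & regular g d].
(* Dividing by the largest power of x stays in I, since x is not in I, and makes the element regular
   in y. Applied to a remainder of division by g, it yields an order below the minimal d. *)
have Preg g : convergent g -> I g -> g != 0 ->
    exists n d, P d /\ g n d != 0.
  move=> cg Ig /(@is_ord_ex (ps C)) [n [gn g0]]; exists n.
  have [d [gd gd0]] := @is_ord_ex C _ gn; exists d; split=> //.
  pose w : series := fun i j => g (i + n)%N j.
  have cw : convergent w.
    have := convergent_shift n 0 cg; congr convergent.
    by apply/funext => i; apply/funext => j; rewrite addn0.
  exists w; split=> //.
  have := Ig; rewrite (@shift_row _ n g) => [|i j /g0 -> //]; move=> /Ip.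
  case=> //; first exact/convergentX/convergent_sx.
  by rewrite /I pullX => /(sprimeX pv (cp _ (@convergent_sx R)) v0).
have exP : exists d, `[< P d >].
  by have [n [d [Pd _]]] := Preg f cf If f0; exists d; apply/asboolP.
case: (ex_minnP exP) => d /asboolP[g [cg Ig [gd gd0]]] dmin.
have factor h : convergent h -> I h -> sdvd g h.
  move=> ch Ih; have [q [cq qE]] := weierstrass_division cg ch gd gd0.
  apply/sdvdP; exists q => //; apply: contrapT => /eqP.
  rewrite -subr_eq0 mulrC => /Preg [| |n [k [Pk]]].
  - by apply/convergentB => //; apply: convergentM.
  - rewrite /I; have -> : h - q * g = h + (- q) * g by rewrite mulNr.
    rewrite pullD pullM; apply: sdvdD => //; apply: sdvd_mull Ig.
    exact/cp/convergentN.
  by rewrite qE ?eqxx //; apply: dmin; apply/asboolP.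
(* A generator g of order 0 would be a unit. Otherwise g_y has order one less and is not in I; from
   f = g q and f_y in I follows q in I, so g^2 divides f. *)
case: d gd gd0 dmin => [|d] gd gd0 dmin; first exact: (I1 g).
have /sdvdP[q cq fE] := factor f cf If.
have g00 := gd0 0%N isT.
have : I (dy g * q).
  rewrite /I -(addrK (pull Q (g * dy q)) (pull Q (dy g * q))) -pullD -dyM -fE.
  by apply: sdvdB Ify _; rewrite pullM; apply: sdvd_mulr Ig; apply/cp/convergent_dy.
case/Ip => //; first exact: convergent_dy.
  move=> Idy; suff /dmin : `[< P d >] by rewrite ltnn.
  apply/asboolP; exists (dy g); split=> //; first exact: convergent_dy.
  rewrite /dy /swap /dx; split=> [|j jd]; last by rewrite gd0 ?mul0rn.
  by rewrite -mulr_natr mulf_neq0 // pnatr_eq0.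
move=> /(factor q cq)/sdvdP[q' cq' qE].
by apply: (nosq g) => //; apply/sdvdP; exists q'; rewrite // fE qE mulrA.
Qed.

End Reducedness.

(** * Exceptional curves and normal crossings *)

Section Exceptional.
Variable R : realType.
Local Notation C := R[i].
Local Notation series := (series R).
Implicit Types (e f g h l u v : series) (s t Q : inpt R).

(* The paths from P.c to the points proximate to P, for any direction c at P. *)
Definition exc_path t :=
  if t is c :: t' then (c == None) && all (pred1 (Some 0)) t' else true.

Lemma strict_sy t : all (pred1 (Some 0)) t -> strict t sy = sy :> series.
Proof. by elim: t => //= c t IH /andP[/eqP -> /IH]; rewrite strict1_0_sy. Qed.

Lemma strict_sy_unit t : ~~ all (pred1 (Some 0)) t ->
  (strict t sy : series) 0%N 0%N != 0.
Proof.
elim: t => //= -[a|] t IH; rewrite negb_and => H; last first.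
  by rewrite strict1_None_sy strict_1 -soneE oner_eq0.
have [a0|a0] := eqVneq a 0.
  by move: H; rewrite a0 eqxx /= strict1_0_sy; apply: IH.
apply: strict_unit; have [-> _] := strict1_smooth_Some a (smooth_sy R).
by rewrite /sy /swap /sx /= add0r mul1r.
Qed.

Lemma strict_sx t : exc_path t ->
  strict t sx = (if t is [::] then sx else sy) :> series.
Proof.
by case: t => //= c t /andP[/eqP -> al]; rewrite strict1_None_sx strict_sy.
Qed.

Lemma strict_sx_unit t : ~~ exc_path t -> (strict t sx : series) 0%N 0%N != 0.
Proof.
case: t => //= -[a|] t; last by rewrite strict1_None_sx; apply: strict_sy_unit.
by rewrite strict1_sx strict_1 -soneE oner_eq0.
Qed.

Lemma exc_path_vanish t :
  exc_path t = ((strict t sx : series) 0%N 0%N == 0).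
Proof.
case E : (exc_path t); last by rewrite (negPf (strict_sx_unit (negbT E))).
by rewrite strict_sx //; case: t {E} => [|? ?]; rewrite eqxx.
Qed.

Lemma exc_path_smooth t : exc_path t -> smooth (strict t sx : series).
Proof. by move/strict_sx ->; case: t => *; [apply: smooth_sx|apply: smooth_sy]. Qed.

Lemma mult0_le f i j : f i j != 0 -> (mult0 f <= i + j)%N.
Proof.
move=> fij; have f0 : f != 0 by apply: contraNneq fij => ->.
rewrite leqNgt; apply/negP => lt; have [_ /(_ _ lt)] := is_ord_pull1 None f0.
by move=> /pull1_row_eq0 /(_ i j erefl) E; rewrite E eqxx in fij.
Qed.

(* The intersection number with a smooth exceptional curve drops by the
   multiplicity after the blowup of its point; is_ord (f 0) is the intersection
   number with x = 0 and is_ord (swap f 0) the one with y = 0. *)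
Lemma is_ord_strict1_None f n : is_ord (f 0%N : ps C) n ->
  (mult0 f <= n)%N /\
  is_ord (swap (strict1 None f) 0%N : ps C) (n - mult0 f)%N.
Proof.
move=> [fn f0]; have mn := mult0_le fn; split=> //.
have E k : swap (strict1 None f) 0%N k = f 0%N (k + mult0 f)%N.
  by rewrite /swap /strict1 /pull1 /= subn0.
split=> [|i ni]; rewrite E; first by rewrite subnK.
by apply: f0; lia.
Qed.

Lemma is_ord_strict1_Some0 f n : is_ord (swap f 0%N : ps C) n ->
  (mult0 f <= n)%N /\
  is_ord (swap (strict1 (Some 0) f) 0%N : ps C) (n - mult0 f)%N.
Proof.
move=> [fn f0]; have mn : (mult0 f <= n)%N.
  by rewrite -[n]addn0; exact: (@mult0_le f n 0%N fn).
split=> //.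
have E k : swap (strict1 (Some 0) f) 0%N k = f (k + mult0 f)%N 0%N.
  rewrite /swap /strict1 pull1_SomeE addr0 comp_polyXr coef_poly /=.
  by rewrite subn0.
split=> [|i ni]; rewrite E; first by rewrite subnK.
by apply: f0; lia.
Qed.

(** Along the points of the exceptional curve, its intersection number with the transforms of g
    stays finite, whereas a common component v would make it infinite. *)
Lemma exc_coprime t v g : v 0%N 0%N = 0 -> irreducible v -> g 0%N != 0 ->
  sdvd v (strict t sx) -> sdvd v (strict t g) -> False.
Proof.
move=> v0 iv g0 vx vg.
have exc : exc_path t by rewrite exc_path_vanish (sdvd_00 vx).
have dvd_exc w : irreducible w -> sdvd v w -> sdvd w (strict t g).
  by move=> iw vw; apply: sdvd_trans vg; apply: irreducible_sdvd_sym.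
move: vx; rewrite strict_sx //; case: t exc dvd_exc {vg} => [|c t] /=.
  move=> _ H /H -/(_ (@sx_irreducible R)).
  by move=> /sdvdP[h _ E]; case/eqP: g0; rewrite E row0_sxM.
move=> /andP[/eqP -> al] H /H -/(_ (@sy_irreducible R)).
move=> {H} /sdvd_swap/sdvdP[h _ E].
have [n og] := @is_ord_ex C _ g0.
have [_] := is_ord_strict1_None og; move: (_ - _)%N (strict1 None g) E => {og g0}.
elim: t al => [|d t IH] /=.
  by move=> _ k g' E [/eqP]; case; rewrite E /sy swapK -[sx]expr1 sxME.
move=> /andP[/eqP -> /IH {}IH] k g' E og.
by have [_ /(IH _ _ E)] := is_ord_strict1_Some0 og.
Qed.

(** Each blowup splits the pullback into a power of the new exceptional curve and a strict
    transform; a prime v divides a transform of one of these. *)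
Lemma sdvd_pull t v f : sprime v -> v 0%N 0%N = 0 -> convergent f -> f != 0 ->
  sdvd v (pull t f) -> sdvd v (strict t f) \/
  exists s c t', t = s ++ c :: t' /\ sdvd v (strict t' sx).
Proof.
move=> pv v0; elim: t f => [|c t IH] f cf f0 /=; first by left.
rewrite (pull1_strict1 c f0) pullM => /pv[|||].
- exact/convergent_pull/convergentX/convergent_sx.
- exact/convergent_pull/convergent_strict1.
- rewrite pullX => /(sprimeX pv (convergent_pull t (@convergent_sx R)) v0).
  move=> /(IH _ (@convergent_sx R) (@sx_neq0 R))[H|[s [d [t' [-> H]]]]]; right.
    by exists [::], c, t.
  by exists (c :: s), d, t'.
move=> /(IH _ (convergent_strict1 c cf) (strict1_neq0 c f0))[]; first by left.
by move=> [s [d [t' [-> H]]]]; right; exists (c :: s), d, t'.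
Qed.

(** This supplies the hypothesis under which double components descend to f. *)
Lemma strict_nonexceptional Q v f : convergent v -> smooth v -> f != 0 ->
  sdvd v (strict Q f) ->
  forall s c t, Q = s ++ c :: t -> ~ sdvd v (pull t sx).
Proof.
move=> cv sv f0 vf s c t E; have pv := smooth_prime cv sv; have [v0 _] := sv.
have coprime s' c' t' : Q = s' ++ c' :: t' -> ~ sdvd v (strict t' sx).
  move=> E' vx; move: vf; rewrite E' strict_cat /= => vf.
  apply: (exc_coprime v0 (smooth_irreducible cv sv) _ vx vf).
  exact/strict1_row0/strict_neq0.
move=> /(sdvd_pull pv v0 (@convergent_sx R) (@sx_neq0 R))[].
  exact: coprime E.
move=> [s' [c' [t' [E']]]]; apply: (coprime (s ++ c :: s') c' t').
by rewrite E E' -catA.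
Qed.

Lemma pull_neq0 t f : f != 0 -> pull t f != 0.
Proof. by elim: t f => //= c t IH f f0; rewrite IH ?pull1_neq0. Qed.

Lemma pull_strict t f : convergent f -> f != 0 ->
  exists E, [/\ convergent E, E != 0 & pull t f = E * strict t f].
Proof.
elim: t f => [|c t IH] f cf f0 /=.
  by exists 1; rewrite mul1r oner_eq0; split=> //; apply: convergent1.
have [E [cE E0 ->]] := IH _ (convergent_pull1 c cf) (pull1_neq0 c f0).
rewrite {1}(pull1_strict1 c f0) strictM ?series_expf_neq0 ?strict1_neq0 ?sx_neq0 //.
exists (E * strict t (sx ^+ mult0 f)); rewrite mulrA; split=> //.
  exact/convergentM/convergent_strict/convergentX/convergent_sx.
by rewrite series_mulf_neq0 // strict_neq0 // series_expf_neq0 // sx_neq0.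
Qed.

Lemma sdvd_prime_power v w n : convergent v -> smooth v -> convergent w ->
  sdvd w (v ^+ n) -> exists k, exists2 e, sunit e & w = e * v ^+ k.
Proof.
move=> cv sv; have pv := smooth_prime cv sv.
elim: n w => [|n IH] w cw /sdvdP[h ch].
  rewrite expr0 => E; exists 0%N, w; rewrite ?expr0 ?mulr1 //; split=> //.
  apply/eqP => w0; have /eqP := congr1 (fun f : series => f 0%N 0%N) E.
  by rewrite serME !big_ord1 w0 mul0r -soneE oner_eq0.
have v0 := smooth_neq0 sv.
rewrite exprS => E; have : sdvd v (w * h).
  by rewrite -E; apply: sdvd_mulr (sdvd_refl _); apply: convergentX.
move=> /pv[//|//||] /sdvdP[w' cw' wE].
  have [||k [e ue w'E]] := IH w'; rewrite //.
    by apply/sdvdP; exists h => //; apply: (series_mulI v0); rewrite E wE mulrA.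
  by exists k.+1, e => //; rewrite wE w'E exprS mulrCA.
apply: IH => //; apply/sdvdP; exists w' => //; apply: (series_mulI v0).
by rewrite E wE mulrCA.
Qed.

Lemma sy_ndvd_sx : ~ sdvd sy (sx : series).
Proof.
move=> /sdvdP[h _ /(congr1 (fun f : series => f 1%N 0%N))/eqP].
by rewrite serM_10 /sy /swap /sx /= !mul0r addr0 oner_eq0.
Qed.

(** Here u is the last exceptional curve x = 0. Comparing orders along it and cancelling x^a leaves
    a unit times v^b, so the strict transform is a unit times v^k. It vanishes, hence k > 0;
    reducedness excludes k > 1; and k = 1 makes it transversal to x = 0. The second conclusion is
    used at a corner: if y = 0 is in the total transform, it must be v itself. *)
Lemma normal_crossings_strict_core s c f u v e a b :
  reduced_curve f -> convergent u -> smooth u -> convergent v -> smooth v ->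
  jacobian u v != 0 -> sunit e ->
  pull (rcons s c) f = e * (u ^+ a * v ^+ b) ->
  strict (rcons s c) f 0%N 0%N = 0 -> sdvd sx u ->
  strict (rcons s c) f 0%N 1%N != 0 /\
  (sdvd sy (pull (rcons s c) f) -> sdvd sy (strict (rcons s c) f)).
Proof.
move=> rf cu su cv sv J ue FE S0 xu; have [cf f00 fred] := rf.
set F := pull _ f in FE *; set S := strict _ f in S0 *.
have f0 : f != 0.
  apply/eqP => E; apply: (fred sx (@convergent_sx R)) => //.
  by rewrite E; apply: sdvd0.
have [e' [ce' e'0] uE] :=
  smooth_sdvd (@convergent_sx R) (smooth_sx R) cu su xu.
have v1 : v 0%N 1%N != 0.
  apply: contraNneq J => v1; rewrite /jacobian v1 mulr0 uE serM_01 /sx /=.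
  by rewrite !mulr0 addr0 mul0r subrr.
have vr : v 0%N != 0 by apply: contraNneq v1 => ->.
have [E [cE E0 pE]] := pull_strict s cf f0.
pose p := pull s f; have p0 : p != 0 by apply: pull_neq0.
have FT : F = sx ^+ mult0 p * strict1 c p.
  by rewrite /F -cats1 pull_cat /= pull1_strict1.
have TS : strict1 c p = strict1 c E * S.
  by rewrite /p pE strict1M ?strict_neq0 // /S -cats1 strict_cat.
have FE' : F = sx ^+ a * (e * e' ^+ a * v ^+ b).
  by rewrite FE uE exprMn; ring.
have ue'' : sunit (e * e' ^+ a).
  apply: sunitM => //; elim: (a) => [|n IH]; first exact: sunit1.
  by rewrite exprS; apply: sunitM.
have r0 : (e * e' ^+ a * v ^+ b) 0%N != 0.
  apply: row0_mulf_neq0; first by case: ue'' => _; apply: contraNneq => ->.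
  elim: (b) => [|n IH]; first exact: one_row0.
  by rewrite exprS; apply: row0_mulf_neq0.
have ma : mult0 p = a.
  apply: (@is_ord_uniq _ (F : ps (ps C))).
    by rewrite FT; apply: is_ord_sxM; apply: strict1_row0.
  by rewrite FE'; apply: is_ord_sxM.
have TE : strict1 c p = e * e' ^+ a * v ^+ b.
  apply: (@series_mulI _ (sx ^+ a)); first by rewrite series_expf_neq0 // sx_neq0.
  by rewrite -FE' -ma.
have cS : convergent S by apply: convergent_strict.
have [k [w uw SE]] : exists k, exists2 w, sunit w & S = w * v ^+ k.
  apply: (@sdvd_prime_power v S b) => //; apply: (sdvd_unit_mul ue'').
  by rewrite -TE TS; apply: sdvd_mull (sdvd_refl _); apply: convergent_strict1.
have SF : sdvd S F.
  rewrite FT TS mulrA; apply: sdvd_mull (sdvd_refl _).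
  apply: convergentM; last exact: convergent_strict1.
  exact/convergentX/convergent_sx.
have [cw w0] := uw.
case: k SE => [|[|k]].
- by rewrite expr0 mulr1 => E'; rewrite E' in S0; rewrite S0 eqxx in w0.
- rewrite expr1 => SE; split.
    have [v0 _] := sv.
    by rewrite SE serM_01 v0 mulr0 addr0 mulf_neq0.
  rewrite FE' => /sy_prime[|||].
  + exact/convergentX/convergent_sx.
  + by apply: convergentM; [case: ue''|apply: convergentX].
  + by move=> /(sprimeX (@sy_prime R) (@convergent_sx R) erefl)/sy_ndvd_sx.
  move=> /(sdvd_unit_mul ue'')/(sprimeX (@sy_prime R) cv erefl).
  by rewrite SE; apply: sdvd_mull.
move=> SE; exfalso; apply: (@reduced_pull_squarefree _ (rcons s c) v f) => //.
- by case: (s).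
- apply: (@strict_nonexceptional _ v f) => //; rewrite -/S SE exprS.
  apply: sdvd_mull => //; apply: sdvd_mulr (sdvd_refl _); exact: convergentX.
apply: sdvd_trans SF; rewrite SE !exprS; apply: sdvd_mull => //.
by rewrite mulrA; apply: sdvd_mulr (sdvd_refl _); apply: convergentX.
Qed.

Lemma local_coordinatesP u v : local_coordinates u v <->
  [/\ convergent u, smooth u, convergent v, smooth v & jacobian u v != 0].
Proof.
split=> [[cu cv u0 v0 J]|[cu [u0 _] cv [v0 _] J]]; last by split.
split=> //; split=> //.
  have [E|] := eqVneq (u 1%N 0%N) 0; last by left.
  by right; apply: contraNneq J => E'; rewrite E E' !mul0r subrr.
have [E|] := eqVneq (v 1%N 0%N) 0; last by left.
by right; apply: contraNneq J => E'; rewrite E E' !mulr0 subrr.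
Qed.

(** The point is not O, so x divides the total transform and is one of its two branches; by symmetry
    it may be called u. *)
Lemma normal_crossings_strict s c f :
  reduced_curve f -> normal_crossings (pull (rcons s c) f) ->
  strict (rcons s c) f 0%N 0%N = 0 ->
  strict (rcons s c) f 0%N 1%N != 0 /\
  (sdvd sy (pull (rcons s c) f) -> sdvd sy (strict (rcons s c) f)).
Proof.
move=> rf [u [v [e [a [b []]]]]] /local_coordinatesP[cu su cv sv J] ce e0 FE S0.
have ue : sunit e by split=> //; apply/eqP.
rewrite !smulE !spowE in FE.
have [cf f00 fred] := rf.
have f0 : f != 0.
  apply/eqP => E; apply: (fred sx (@convergent_sx R)) => //.
  by rewrite E; apply: sdvd0.
have xF : sdvd sx (pull (rcons s c) f).
  have [E [cE E0 pE]] := pull_strict s cf f0.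
  have p0 : pull s f != 0 by rewrite pE series_mulf_neq0 // strict_neq0.
  have m0 : (0 < mult0 (pull s f))%N by rewrite mult0_gt0 ?pull_00.
  rewrite -cats1 pull_cat /= pull1_strict1 // -(prednK m0) exprS -mulrA.
  apply: sdvd_mulr (sdvd_refl _); apply: convergentM.
    exact/convergentX/convergent_sx.
  exact/convergent_strict1/convergent_pull.
have px := @sx_prime R.
have : sdvd sx (u ^+ a * v ^+ b) by apply: (sdvd_unit_mul ue); rewrite -FE.
move=> /px[||/(sprimeX px cu erefl)|/(sprimeX px cv erefl)].
- exact: convergentX.
- exact: convergentX.
- exact: (normal_crossings_strict_core rf cu su cv sv J ue FE S0).
apply: (@normal_crossings_strict_core s c f v u e b a rf cv sv cu su _ ue _ S0).
  by rewrite /jacobian -oppr_eq0 opprB [v 0%N 1%N * _]mulrC [_ * u 0%N 1%N]mulrC.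
by rewrite FE [u ^+ a * _]mulrC.
Qed.

End Exceptional.
Arguments exc_path {R} t.

(** * The proximity equality *)

Section Directions.
Variable R : realType.
Local Notation C := R[i].
Local Notation series := (series R).
Implicit Types (f g h : series).

Lemma strict1_Some_row0 a f k :
  strict1 (Some a) f 0%N k = (homog (mult0 f) f \Po ('X + a%:P))`_k.
Proof. by rewrite /strict1 pull1_SomeE. Qed.

Lemma strict1_None_row0 f k : strict1 None f 0%N k =
  if (k <= mult0 f)%N then (homog (mult0 f) f)`_(mult0 f - k) else 0.
Proof.
rewrite /strict1 /= add0n; case: leqP => // km.
by rewrite coef_poly ltnS leq_subr subKn.
Qed.

Lemma homog_mult0_neq0 f : f != 0 -> homog (mult0 f) f != 0.
Proof.
move=> /(strict1_row0 (Some 0)); apply: contraNneq => h0.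
by apply/eqP/funext => k; rewrite strict1_Some_row0 h0 comp_poly0 coef0.
Qed.

Lemma sum_count_mem_undup (T : eqType) (r : seq T) :
  (\sum_(x <- undup r) count_mem x r)%N = size r.
Proof.
under eq_bigr do rewrite -sum1_count big_mkcond.
rewrite exchange_big /= -sum1_size; apply: eq_big_seq => y ry.
rewrite -big_mkcond (eq_bigl (pred1 y)) => [|x]; last by rewrite /= eq_sym.
by rewrite sum1_count count_uniq_mem ?undup_uniq // mem_undup ry.
Qed.

(** The initial form of f is a binary form of degree [mult0 f], which splits over C; the
    intersection numbers with the exceptional curve are the multiplicities of its linear factors. *)
Lemma tangent_directions f : f != 0 ->
  exists (cs : seq (option C)) (I : option C -> nat), [/\ uniq cs,
    forall c, is_ord (strict1 c f 0%N : ps C) (I c),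
    forall c, strict1 c f 0%N 0%N = 0 -> c \in cs &
    (\sum_(c <- cs) I c)%N = mult0 f].
Proof.
move=> f0; set m := mult0 f; pose p := homog m f.
have p0 : p != 0 := homog_mult0_neq0 f0.
have [r pE] := closed_field_poly_normal p.
have l0 : lead_coef p != 0 by rewrite lead_coef_eq0.
have szp : size p = (size r).+1 by rewrite pE size_scale // size_prod_XsubC.
have rm : (size r <= m)%N by rewrite -ltnS -szp size_poly.
(* The degree lost in dehomogenising is the multiplicity of the factor x, that is of the vertical
   direction. *)
pose I (c : option C) := if c is Some a then count_mem a r else (m - size r)%N.
have oI c : is_ord (strict1 c f 0%N : ps C) (I c).
  case: c => [a|] /=.
    pose q := lead_coef p *: \prod_(z <- r | z != a) ('X - z%:P).
    have pq : p = ('X - a%:P) ^+ count_mem a r * q.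
      rewrite pE (bigID (pred1 a)) /= scalerAr; congr (_ * _).
      rewrite -big_filter (eq_big_seq (fun=> 'X - a%:P)) => [|z].
        by rewrite big_const_seq count_predT size_filter iter_mulr_1.
      by rewrite mem_filter => /andP[/eqP ->].
    have coefE k : strict1 (Some a) f 0%N k =
        if (k < count_mem a r)%N then 0
        else (q \Po ('X + a%:P))`_(k - count_mem a r).
      rewrite strict1_Some_row0 -/m -/p pq rmorphM rmorphXn /= rmorphB /=.
      by rewrite comp_polyX comp_polyC addrK coefXnM.
    split=> [|k km]; rewrite coefE ?km // ltnn subnn.
    rewrite -horner_coef0 horner_comp !hornerE ?add0r mulf_neq0 //.
    rewrite horner_prod prodf_seq_neq0; apply/allP => z _; apply/implyP => za.
    by rewrite hornerXsubC subr_eq0 eq_sym.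
  split=> [|k km]; rewrite strict1_None_row0 -/m -/p.
    by rewrite leq_subr subKn // -[size r]/(size r).+1.-1 -szp.
  by case: ifP => // km'; rewrite nth_default // szp ltn_subRL addnC -ltn_subRL.
exists (None :: map Some (undup r)), I; split=> //.
- by rewrite /= map_inj_uniq ?undup_uniq ?andbT => [|? ? [->]//]; apply/mapP => -[].
- case=> [a|_]; rewrite !inE //= => c0.
  rewrite mem_map => [|? ? [->]//]; rewrite mem_undup -has_pred1 has_count.
  by rewrite lt0n; apply/eqP => E; have [/eqP] := oI (Some a); rewrite /= E.
- by rewrite big_cons big_map /= sum_count_mem_undup subnK.
Qed.

End Directions.

Section Proximity.
Variable R : realType.
Local Notation C := R[i].
Local Notation series := (series R).
Implicit Types (P Q : inpt R) (p : pred (inpt R)).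

Lemma infnear_rcons P Q c : infnear P (rcons Q c) = (P == rcons Q c) || infnear P Q.
Proof.
rewrite /infnear; apply/idP/orP => [|[/eqP ->|]].
- case/prefixP => t; case/lastP: t => [|t d]; first by rewrite cats0 => ->; left.
  by rewrite -rcons_cat => /rcons_inj[-> _]; right; rewrite prefix_prefix.
- exact: prefix_refl.
- by move=> PQ; apply: prefix_trans PQ (prefix_rcons _ _).
Qed.

Lemma sinfnear_rcons P Q c : sinfnear P (rcons Q c) = infnear P Q.
Proof.
rewrite /sinfnear infnear_rcons.
case: (eqVneq P (rcons Q c)) => [->|_]; last by rewrite andbT.
rewrite andbF; apply/esym/negbTE/negP => /size_prefix; rewrite size_rcons; lia.
Qed.

Lemma sinfnearP P Q : reflect (exists c t, Q = P ++ c :: t) (sinfnear P Q).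
Proof.
apply: (iffP andP) => [[/prefixP[[|c t] ->]]|[c [t ->]]]; first by rewrite cats0 eqxx.
  by exists c, t.
split; first exact: prefix_prefix.
by apply/eqP => /(congr1 size); rewrite size_cat /=; lia.
Qed.

Lemma infnear_sinfnear_trans P Q S : infnear P Q -> sinfnear Q S -> sinfnear P S.
Proof.
move=> /prefixP[t ->] /sinfnearP[c [t' ->]]; apply/sinfnearP; rewrite -catA.
by case: t => [|d t]; [exists c, t'|exists d, (t ++ c :: t')].
Qed.

Variables (f : series) (D : set (inpt R)) (s : seq (inpt R)).
Hypotheses (f_reduced : reduced_curve f) (s_uniq : uniq s)
  (sP : forall P, P \in s <->
     (forall Q, sinfnear Q P -> D Q) /\ strict P f 0%N 0%N = 0)
  (D_resolution : forall P, on_model D P -> normal_crossings (pull P f)).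

Let cf : convergent f. Proof. by case: f_reduced. Qed.

Lemma reduced_neq0 : f != 0.
Proof.
case: f_reduced => _ _ H; apply/eqP => E; apply: (H sx (@convergent_sx R)) => //.
by rewrite E; apply: sdvd0.
Qed.

Let Sf0 P : strict P f != 0. Proof. exact/strict_neq0/reduced_neq0. Qed.

(** Paths along an exceptional curve that has become y = 0: the tails of [exc_path] after its first
    step. *)
Let corner_path : pred (inpt R) := fun t => all (pred1 (Some 0)) t.

Let under p Q Q' := infnear Q Q' && p (drop (size Q) Q').

Let underP p Q Q' : reflect (exists2 t, Q' = Q ++ t & p t) (under p Q Q').
Proof.
apply: (iffP andP) => [[/prefixP[t ->]]|[t -> pt]].
  by rewrite drop_size_cat //; exists t.
by rewrite drop_size_cat // /infnear prefix_prefix.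
Qed.

Let under_self p Q c : ~~ under p (rcons Q c) Q.
Proof.
by apply/underP => -[t /(congr1 size)]; rewrite size_cat size_rcons; lia.
Qed.

Let under_step p (p' : pred (inpt R)) Q c Q' :
  (forall t, p t = if t is d :: t' then (d == c) && p' t' else true) ->
  under p Q Q' = (Q' == Q) || under p' (rcons Q c) Q'.
Proof.
move=> pE; apply/underP/orP => [[[|d t] ->]|[/eqP ->|/underP[t -> pt]]].
- by rewrite cats0; left.
- rewrite pE => /andP[/eqP -> pt]; right; apply/underP; exists t => //.
  by rewrite cat_rcons.
- by exists [::]; rewrite ?cats0 ?pE.
- by exists (c :: t); rewrite ?cat_rcons // pE eqxx.
Qed.

Lemma mem_above Q Q' : infnear Q Q' -> Q' \in s -> strict Q f 0%N 0%N = 0.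
Proof.
move=> /prefixP[t ->] /sP[_]; rewrite strict_cat => S0.
by apply/eqP; apply: contraTT (introT eqP S0) => /strict_unit; apply.
Qed.

Lemma not_D_maximal Q Q' : ~ D Q -> infnear Q Q' -> Q' \in s -> Q' = Q.
Proof.
move=> DQ QQ' /sP[H _]; apply: contrapT => /eqP ne.
by apply/DQ/H; rewrite /sinfnear QQ' eq_sym.
Qed.

Lemma rcons_mem Q c : (forall P, sinfnear P Q -> D P) -> D Q ->
  forall P, sinfnear P (rcons Q c) -> D P.
Proof.
move=> H DQ P; rewrite sinfnear_rcons => PQ.
have [->//|ne] := eqVneq P Q; by apply: H; rewrite /sinfnear PQ.
Qed.

Let sum_step p (p' : pred (inpt R)) Q c :
  (forall t, p t = if t is d :: t' then (d == c) && p' t' else true) ->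
  Q \in s ->
  (\sum_(Q' <- s | under p Q Q') mult0 (strict Q' f) = mult0 (strict Q f) +
   \sum_(Q' <- s | under p' (rcons Q c) Q') mult0 (strict Q' f))%N.
Proof.
move=> pE sQ; rewrite big_mkcond (bigD1_seq Q) //= (under_step _ _ pE) eqxx.
congr (_ + _)%N; rewrite -big_mkcondr; apply: eq_bigl => Q' /=.
rewrite (under_step _ _ pE); have [->|//] := eqVneq Q' Q.
by apply/esym/negbTE/under_self.
Qed.

(** Here y = 0 is a component of the total transform and n is its intersection number with the
    strict transform. While n > 0, the point Q must be blown up: normal crossings at Q would make y
    = 0 a component of the strict transform and n infinite. Blowing up lowers n by the multiplicity
    at Q. *)
Lemma sum_corner n s' c : let Q := rcons s' c in sdvd sy (pull Q f) ->
  (forall P, sinfnear P Q -> D P) ->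
  is_ord (swap (strict Q f) 0%N : ps C) n ->
  (\sum_(Q' <- s | under corner_path Q Q') mult0 (strict Q' f))%N = n.
Proof.
elim/ltn_ind: n s' c => n IH s' c Q yQ predQ oQ.
have [n0|n_gt0] := posnP n.
  rewrite n0 in oQ *; rewrite big_seq_cond big1 // => Q' /andP[sQ' /andP[QQ' _]].
  by have := mem_above QQ' sQ'; case: oQ => /eqP; rewrite /swap.
have S0 : strict Q f 0%N 0%N = 0 by case: oQ => _ /(_ 0%N n_gt0).
have sQ : Q \in s by apply/sP.
have DQ : D Q.
  apply: contrapT => DQ; have nc := D_resolution (conj DQ predQ).
  have [_ /(_ yQ)/sdvd_swap/sdvdP[h _ E]] := normal_crossings_strict f_reduced nc S0.
  by case: oQ => /eqP; rewrite E /sy swapK -[sx]expr1 sxME.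
have [mn on] := is_ord_strict1_Some0 oQ.
have m0 : (0 < mult0 (strict Q f))%N by apply: mult0_gt0.
rewrite (@sum_step _ corner_path _ (Some 0)) //; last by case.
rewrite (IH (n - mult0 (strict Q f))%N) ?subnKC //; first lia.
- rewrite -cats1 pull_cat /=; have /sdvdP[h ch ->] := yQ.
  rewrite pull1M pull1_strict1 ?sy_neq0 // strict1_0_sy mulrAC.
  apply: sdvd_mull (sdvd_refl _); apply: convergentM; last exact: convergent_pull1.
  exact/convergentX/convergent_sx.
- exact: rcons_mem.
- by rewrite -cats1 strict_cat.
Qed.

Lemma sum_direction n P c : let Q := rcons P c in
  D P -> (forall S, sinfnear S P -> D S) -> strict P f 0%N 0%N = 0 ->
  is_ord (strict Q f 0%N : ps C) n ->
  (\sum_(Q' <- s | under exc_path Q Q') mult0 (strict Q' f))%N = n.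
Proof.
move=> Q DP predP P0 oQ.
have predQ : forall S, sinfnear S Q -> D S := rcons_mem predP DP.
have [n0|n_gt0] := posnP n.
  rewrite n0 in oQ *; rewrite big_seq_cond big1 // => Q' /andP[sQ' /andP[QQ' _]].
  by have := mem_above QQ' sQ'; case: oQ => /eqP.
have S0 : strict Q f 0%N 0%N = 0 by case: oQ => _ /(_ 0%N n_gt0).
have sQ : Q \in s by apply/sP.
have excE t : exc_path t =
    if t is d :: t' then (d == None) && corner_path t' else true by case: t.
(* If Q is not blown up, it is the last point and the transversality to x = 0 gives n = 1. Otherwise
   the curve x = 0 continues through the next point in direction [None], as y = 0. *)
have [DQ|DQ] := pselect (D Q); last first.
  have nc := D_resolution (conj DQ predQ).
  have [S1 _] := normal_crossings_strict f_reduced nc S0.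
  have -> : n = 1%N by apply: is_ord_uniq oQ _; split=> // -[].
  rewrite (sum_step excE) // big_seq_cond big1 ?addn0 => [|Q'].
    by apply: mult0_smooth; split=> //; right.
  move=> /andP[sQ' uQ']; have QQ' : infnear Q Q'.
    have : under exc_path Q Q' by rewrite (under_step _ _ excE) uQ' orbT.
    by case/andP.
  by have := @under_self corner_path Q None; rewrite -{2}(not_D_maximal DQ QQ' sQ') uQ'.
have [mn on] := is_ord_strict1_None oQ.
rewrite (sum_step excE) // (@sum_corner (n - mult0 (strict Q f)) Q None) ?subnKC //.
(* The total transform at Q is divisible by x, which pulls back to x y. *)
- rewrite -cats1 pull_cat /= /Q -cats1 pull_cat /=.
  rewrite [pull1 c _]pull1_strict1 ?pull_neq0 ?reduced_neq0 //.
  have m0 : (0 < mult0 (pull P f))%N.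
    by rewrite mult0_gt0 ?pull_00 ?pull_neq0 ?reduced_neq0 //; case: f_reduced.
  rewrite -(prednK m0) exprS -mulrA !pull1M pull1_None_sx [sx * sy]mulrC -!mulrA.
  apply: sdvd_mulr (sdvd_refl _); apply: convergentM; first exact: convergent_sx.
  apply: convergentM; apply: convergent_pull1.
    exact/convergentX/convergent_sx.
  exact/convergent_strict1/convergent_pull.
- exact: rcons_mem.
- by rewrite -cats1 strict_cat.
Qed.

Lemma multiplicityE g Q : multiplicity g Q = mult0 (strict Q g).
Proof. by rewrite /multiplicity /strict_at drop0. Qed.

Lemma proximity_equality P : D P -> P \in s ->
  (\sum_(Q <- s | sinfnear P Q && exc_path (drop (size P).+1 Q))
     multiplicity f Q)%N = multiplicity f P.
Proof.
move=> DP sP'; have [predP P0] := (sP P).1 sP'.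
rewrite multiplicityE; under eq_bigr do rewrite multiplicityE.
have [cs [I [cs_uniq oI csP <-]]] := tangent_directions (Sf0 P).
have IE c : I c =
    (\sum_(Q' <- s | under exc_path (rcons P c) Q') mult0 (strict Q' f))%N.
  by rewrite (@sum_direction (I c)) // -cats1 strict_cat; apply: oI.
under [RHS]eq_bigr do rewrite IE big_mkcond.
rewrite exchange_big big_mkcond /=; apply: eq_big_seq => Q sQ.
rewrite -big_mkcond; case: sinfnearP => [[c [t QE]]|PQ] /=; last first.
  rewrite big1 // => c /underP[t QE _]; case: PQ; exists c, t.
  by rewrite QE cat_rcons.
(* A point above P lies over a single direction, so it is counted at most once in the double sum. *)
have uc d : under exc_path (rcons P d) Q = (d == c) && exc_path t.
  apply/underP/andP => [[t']|[/eqP -> et]]; last by exists t; rewrite // QE cat_rcons.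
  rewrite QE -cat_rcons => /eqP; rewrite eqseq_cat ?size_rcons //.
  by move=> /andP[/eqP/rcons_inj[->] /eqP <-].
rewrite QE -cat_rcons drop_size_cat ?size_rcons // cat_rcons -QE.
rewrite (eq_bigl _ _ uc); case: (exc_path t); last first.
  by rewrite big1 // => d; rewrite andbF.
under eq_bigl do rewrite andbT.
rewrite -big_filter (filter_pred1_uniq cs_uniq) ?big_seq1 //; apply: csP.
have := (sP Q).1 sQ; rewrite QE strict_cat /= => -[_ H].
by apply/eqP; apply: contraTT (introT eqP H) => /strict_unit; apply.
Qed.

End Proximity.

(** * The lotus *)

Section Lotus.
Variable R : realType.
Local Notation C := R[i].
Local Notation series := (series R).
Variables (A : series) (K : crosses R) (D : set (inpt R)).
Variables (lineL : series) (line : inpt R -> series) (s : seq (inpt R)).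
Hypotheses (A_reduced : reduced_curve A)
  (K_crosses : active_constellation_of_crosses K)
  (K_adapted : adapted_via K A D)
  (K_lines : names_lines K lineL line)
  (s_order : compatible_order K s).
Implicit Types (P Q : inpt R) (u v w : label R) (l : series).

Local Notation germ := (label_germ lineL line).
Local Notation dual := (dual_segment K lineL line).

(** The set of points strictly preceding P is the smallest model on which P lies; it serves as
    witness. *)
Lemma ptsP P : pts K P <->
  (forall Q, sinfnear Q P -> D Q) /\ strict P A 0%N 0%N = 0.
Proof.
have [[[finD cD] _] -> _ _] := K_adapted.
split=> [[D' [_ D'D [_ D'P]]]|[DP P0]].
  by rewrite /vanishes /strict_at drop0 => P0; split=> // Q /D'P /D'D.
exists [set Q | sinfnear Q P]; split.
- split; first exact: sub_finite_set finD.
  by move=> P' Q QP P'Q; apply: infnear_sinfnear_trans QP.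
- exact: DP.
- by split=> //; rewrite /= /sinfnear eqxx andbF.
- by rewrite /vanishes /strict_at drop0.
Qed.

Lemma resolution P : on_model D P -> normal_crossings (pull P A).
Proof. by have [[_ H] _ _ _] := K_adapted => /H; rewrite /total_at drop0. Qed.

Lemma pts_infnear P Q : pts K Q -> infnear P Q -> pts K P.
Proof. by have [H _ _ _ _] := K_crosses; apply: H. Qed.

Lemma sinfnear_active P Q : pts K Q -> sinfnear P Q -> active K P.
Proof.
move=> kQ PQ; have [_ _ H _ _] := K_crosses; apply: H; split; last by exists Q.
by apply: pts_infnear kQ _; case/andP: PQ.
Qed.

Lemma active_pts P : active K P -> pts K P.
Proof. by have [_ H _ _ _] := K_crosses; apply: H. Qed.

Lemma active_D P : active K P -> D P.
Proof.
have [_ _ -> _] := K_adapted => -[_ [Q [/ptsP[H _] PQ]]].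
exact: H.
Qed.

(** If P were blown up, the strict transform would pass through some point of the exceptional curve,
    because its intersection numbers there add up to a positive multiplicity. That point would
    belong to the constellation, and P would not be maximal. *)
Lemma inactive_not_D P : inactive K P -> ~ D P.
Proof.
move=> [kP naP] DP; apply: naP; have [predP P0] := (ptsP P).1 kP.
have S0 : strict P A != 0 by apply/strict_neq0/reduced_neq0.
have [cs [I [_ oI _ sumI]]] := tangent_directions S0.
have [c c0] : exists c, strict1 c (strict P A) 0%N 0%N = 0.
  apply: contrapT => /forallNP H; have := mult0_gt0 S0 P0.
  rewrite -sumI big1 // => c _; apply: is_ord_uniq (oI c) _.
  by split=> //; apply/eqP; apply: H.
apply: (@sinfnear_active _ (rcons P c)); last first.
  by rewrite sinfnear_rcons /infnear prefix_refl.
apply/ptsP; split; first exact: rcons_mem.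
by rewrite -cats1 strict_cat.
Qed.

(** O is set apart: when no blowup is made, A may be a node there, of multiplicity 2. *)
Lemma inactive_multiplicity Q : inactive K Q -> Q != [::] -> multiplicity A Q = 1%N.
Proof.
move=> iQ; have DQ := inactive_not_D iQ; case: iQ => /ptsP[predQ Q0] _.
case/lastP: Q DQ predQ Q0 => // Q c DQ predQ Q0 _.
have nc := resolution (conj DQ predQ).
have [Q1 _] := normal_crossings_strict A_reduced nc Q0.
by rewrite multiplicityE mult0_smooth //; split=> //; right.
Qed.

(* The points P such that the labelled curve exists on the model S^P. *)
Definition born u P : bool :=
  match u with
  | LabL => true
  | LabLine Q => infnear Q P
  | LabExc Q => sinfnear Q P
  end.

Lemma germ_born u P : germ u P 0%N 0%N = 0 -> born u P.
Proof.
by case: u => //= Q; case: ifP => // _ /eqP; rewrite soneE -soneE oner_eq0.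
Qed.

Lemma germ_cat u P t : born u P -> germ u (P ++ t) = strict t (germ u P).
Proof.
case: u => [|Q|Q] /=.
- by move=> _; rewrite /strict_at !drop0 strict_cat.
- move=> /prefixP[r ->]; rewrite /infnear -catA !prefix_prefix /strict_at.
  by rewrite !drop_size_cat // strict_cat.
- move=> /sinfnearP[c [r ->]].
  have dr (x : inpt R) : drop (size Q).+1 (Q ++ c :: x) = x.
    by rewrite -cat_rcons drop_size_cat ?size_rcons.
  have -> : sinfnear Q (Q ++ c :: r) by apply/sinfnearP; exists c, r.
  rewrite -catA /= !dr strict_cat.
  by have -> : sinfnear Q (Q ++ c :: r ++ t) by apply/sinfnearP; exists c, (r ++ t).
Qed.

Lemma line_smooth Q : pts K Q -> fresh K Q -> convergent (line Q) /\ smooth (line Q).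
Proof.
have [L0 _ LQ] := K_lines => kQ fQ; have [->|Q0] := eqVneq Q [::].
  by have /local_coordinatesP[] := L0.
by have [/local_coordinatesP[]] := LQ Q kQ Q0 fQ.
Qed.

Lemma germ_smooth u P : is_label K u ->
  convergent (germ u P) /\ smooth_or_unit (germ u P).
Proof.
have [/local_coordinatesP[cL sL _ _ _] _ _] := K_lines.
have one : convergent (sone : series) /\ smooth_or_unit (sone : series).
  split; first by rewrite soneE; apply: convergent1.
  by right; rewrite oner_eq0.
case: u => [|Q|Q] /= lu.
- rewrite /strict_at; split; first exact: convergent_strict.
  by apply: strict_smooth_or_unit; left.
- case: ifP => // _; rewrite /strict_at; have [cl sl] := line_smooth lu.1 lu.2.
  split; first exact: convergent_strict.
  by apply: strict_smooth_or_unit; left.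
- case: ifP => // _; split; first exact/convergent_strict/convergent_sx.
  by apply: strict_smooth_or_unit; left; apply: smooth_sx.
Qed.

Lemma germ_smooth0 u P : is_label K u -> germ u P 0%N 0%N = 0 -> smooth (germ u P).
Proof. by move=> /(germ_smooth P)[_ [//|/eqP]]. Qed.

(** A smooth branch of the total transform of the cross at P is a strict transform of one of its two
    branches, or the exceptional curve of a point between P and Q; the latter is active, being
    non-maximal. *)
Lemma sdvd_total_label u v P c t l : pts K (P ++ c :: t) ->
  is_label K u -> is_label K v ->
  local_coordinates (germ u P) (germ v P) ->
  associates (cross K P) (smul (germ u P) (germ v P)) ->
  convergent l -> smooth l ->
  sdvd l (pull (c :: t) (cross K P)) ->
  exists2 w, is_label K w & sdvd l (germ w (P ++ c :: t)).
Proof.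
set Q := P ++ c :: t => kQ lu lv /local_coordinatesP[cu su cv sv _].
move=> /associatesP[e [ce e0] ->] cl sl; have pl := smooth_prime cl sl.
have [l0 _] := sl; have cp := @convergent_pull R.
rewrite smulE pullM => /pl[]; [exact: cp|exact/cp/convergentM| |].
  move=> /sdvd_00 /(_ l0); rewrite pull_00 => /eqP; by rewrite (negPf e0).
rewrite pullM.
have H w : is_label K w -> convergent (germ w P) -> smooth (germ w P) ->
    sdvd l (pull (c :: t) (germ w P)) ->
    exists2 w', is_label K w' & sdvd l (germ w' Q).
  move=> lw cw sw /(sdvd_pull pl l0 cw (smooth_neq0 sw))[lS|].
    by exists w => //; rewrite germ_cat // germ_born //; case: sw.
  move=> [s' [d [t' [E lx]]]].
  have WQ : sinfnear (P ++ s') Q by apply/sinfnearP; exists d, t'; rewrite /Q E catA.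
  exists (LabExc (P ++ s')); first exact: sinfnear_active WQ.
  by rewrite /= WQ /Q E catA -cat_rcons drop_size_cat ?size_rcons.
move=> /pl[||/H|/H]; try exact: cp; by apply.
Qed.

(** Induction on the length of P. At a fresh point the two labels are given by the naming of the
    lines; elsewhere the branches come from crosses at earlier points. *)
Lemma cross_labels P : pts K P -> exists u v,
  [/\ is_label K u, is_label K v, local_coordinates (germ u P) (germ v P) &
      associates (cross K P) (smul (germ u P) (germ v P))].
Proof.
have [n] := ubnP (size P); elim: n P => // n IH P Pn kP.
have [L0 aL LP] := K_lines.
have [P0|P0] := eqVneq P [::].
  rewrite P0 in kP *; exists LabL, (LabLine [::]); rewrite /= /strict_at /=.
  by split=> //; split=> //; left.
have [fP|/not_orP[_ /contrapT]] := pselect (fresh K P).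
  have [] := LP P kP P0 fP; case/lastP: P Pn kP P0 fP => // P c _ kP _ fP lc ac.
  have PP : sinfnear P (rcons P c) by rewrite sinfnear_rcons /infnear prefix_refl.
  exists (LabExc P), (LabLine (rcons P c)).
  rewrite /= PP /infnear prefix_refl /strict_at !drop_oversize ?size_rcons //=.
  by split=> //; apply: sinfnear_active PP.
move=> [h [[a [b [/local_coordinatesP[ca sa cb sb J] ->]]] hP]].
have find l : convergent l -> smooth l -> sdvd l (smul a b) ->
    sdvd l (cross K P) /\
    exists2 w, is_label K w & exists2 e, sunit e & germ w P = e * l.
  move=> cl sl lh; have il := smooth_irreducible cl sl.
  have [Q [kQ QP bl]] := (hP l).1 (conj il lh).
  split.
    have [_ _ _ _ sub] := K_crosses.
    by have [] := sub Q P kQ kP (proj1 (andP QP)) l bl.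
  case/sinfnearP: QP => c [t PE]; have Qn : (size Q < n)%N.
    by move: Pn; rewrite PE size_cat /=; lia.
  have [u [v [lu lv uv cuv]]] := IH Q Qn kQ.
  have := bl.2; rewrite /total_at PE drop_size_cat // => lQ.
  have [|w lw lP] := sdvd_total_label _ lu lv uv cuv cl sl lQ; first by rewrite -PE.
  rewrite -PE in lP *; exists w => //; have [cw _] := germ_smooth P lw.
  have w0 := sdvd_00 lP sl.1.
  exact: (smooth_sdvd cl sl cw (germ_smooth0 lw w0) lP).
have [|da [u lu [e ue uE]]] := find a ca sa.
  by rewrite smulE; apply: sdvd_mulr (sdvd_refl _).
have [|db [v lv [e' ue' vE]]] := find b cb sb.
  by rewrite smulE; apply: sdvd_mull (sdvd_refl _).
have [[ce e0] [ce' e0']] := (ue, ue').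
exists u, v; split=> //.
  apply/local_coordinatesP; rewrite uE vE.
  have [cu _] := germ_smooth P lu; have [cv _] := germ_smooth P lv.
  rewrite uE in cu; rewrite vE in cv.
  have J' := jacobian_unit ue ue' sa.1 sb.1 J.
  have u0 : (e * a) 0%N 0%N = 0 by rewrite serME !big_ord1 sa.1 mulr0.
  have v0 : (e' * b) 0%N 0%N = 0 by rewrite serME !big_ord1 sb.1 mulr0.
  by apply/local_coordinatesP; split.
(* The cross at P contains the distinct branches a and b; having only two branches, it equals their
   union. *)
have [_ _ _ /(_ P kP)[x [y [xy crE]]] _] := K_crosses.
have /local_coordinatesP[cx sx' cy sy' _] := xy.
have pa := smooth_prime ca sa; have pb := smooth_prime cb sb.
have nab := jacobian_ndvd sa.1 J.
have nba : ~ sdvd b a.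
  move=> ba; apply: nab; apply: irreducible_sdvd_sym ba; exact: smooth_irreducible.
have [e1 ue1 crE'] : exists2 e1, sunit e1 & cross K P = e1 * (a * b).
  have := da; have := db; rewrite crE smulE => /(pb _ _ cx cy) db' /(pa _ _ cx cy) da'.
  case: da' db' => [ax|ay] [bx|By].
  - case: nba; apply: sdvd_trans bx _.
    by apply: irreducible_sdvd_sym ax; apply: smooth_irreducible.
  - have [e1 ue1 ->] := smooth_sdvd ca sa cx sx' ax.
    have [e2 ue2 ->] := smooth_sdvd cb sb cy sy' By.
    by exists (e1 * e2); [apply: sunitM|ring].
  - have [e1 ue1 ->] := smooth_sdvd ca sa cy sy' ay.
    have [e2 ue2 ->] := smooth_sdvd cb sb cx sx' bx.
    by exists (e1 * e2); [apply: sunitM|ring].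
  - case: nba; apply: sdvd_trans By _.
    by apply: irreducible_sdvd_sym ay; apply: smooth_irreducible.
have [i ui ie] := sunit_inv ue; have [i' ui' ie'] := sunit_inv ue'.
apply/associatesP; exists (e1 * (i * i')); first by do 2!apply: sunitM => //.
rewrite smulE uE vE crE'.
rewrite (_ : _ * (e * a * _) = e1 * ((i * e) * (i' * e') * (a * b))); last by ring.
by rewrite ie ie' !mul1r.
Qed.

Lemma germ_vanish u Q : dual Q u -> germ u Q 0%N 0%N = 0.
Proof. by case=> _ [[]]. Qed.

Lemma dual_cross_labels P u v : is_label K u -> is_label K v ->
  local_coordinates (germ u P) (germ v P) ->
  associates (cross K P) (smul (germ u P) (germ v P)) -> dual P u /\ dual P v.
Proof.
move=> lu lv /local_coordinatesP[cu su cv sv _] /associatesP[e [ce _]].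
rewrite smulE => E; split; split=> //; split; try exact: smooth_irreducible.
  by rewrite E; apply: sdvd_mull => //; apply: sdvd_mulr (sdvd_refl _).
by rewrite E; apply: sdvd_mull => //; apply: sdvd_mull (sdvd_refl _).
Qed.

(** The pullback of a cross at P contains E_P, since its equation vanishes at P. Compatibility of
    the crosses then puts E_P in the cross at Q whenever E_P passes through Q. *)
Lemma exc_in_dual P Q : active K P -> pts K Q -> sinfnear P Q ->
  dual Q (LabExc P) <-> exc_path (drop (size P).+1 Q).
Proof.
move=> aP kQ PQ; split=> [/germ_vanish /=|]; rewrite ?PQ.
  by move=> /eqP; rewrite -exc_path_vanish.
move=> ex; split=> //=; rewrite PQ.
have [_ _ _ isc sub] := K_crosses; have kP := active_pts aP.
apply: (sub P Q kP kQ); first by case/andP: PQ.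
split.
  apply: smooth_irreducible; first exact/convergent_strict/convergent_sx.
  exact: exc_path_smooth.
case/sinfnearP: PQ => c [t QE].
have -> : drop (size P).+1 Q = t by rewrite QE -cat_rcons drop_size_cat ?size_rcons.
rewrite /total_at QE drop_size_cat //=.
have [x [y [/local_coordinatesP[cx sx' cy sy' _] ->]]] := isc P kP.
rewrite smulE pull1M pullM.
apply: sdvd_mulr; first exact/convergent_pull/convergent_pull1.
rewrite pull1_strict1 ?smooth_neq0 // mult0_smooth // expr1 pullM.
apply: sdvd_mulr; first exact/convergent_pull/convergent_strict1.
have [E [cE _ ->]] := pull_strict t (@convergent_sx R) (@sx_neq0 R).
exact: sdvd_mull (sdvd_refl _).
Qed.

Lemma incomparable P Q : ~~ infnear P Q -> ~~ infnear Q P ->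
  exists W c d t t', [/\ P = W ++ c :: t, Q = W ++ d :: t' & c != d].
Proof.
rewrite /infnear; elim: P Q => [|c P IH] [|d Q] //; rewrite ?prefix0s //.
rewrite !prefix_cons [d == c]eq_sym; case: eqVneq => [->|cd _ _].
  by move=> /IH H /H [W [a [b [t [t' [-> -> ab]]]]]]; exists (d :: W), a, b, t, t'.
by exists [::], c, d, P, Q.
Qed.

Lemma strict_vanish t l : strict t l 0%N 0%N = 0 -> l 0%N 0%N = 0.
Proof.
move=> t0; apply/eqP; apply: contraTT (introT eqP t0) => /strict_unit; exact.
Qed.

(* A smooth curve has a single tangent direction, so that a label passing
   through points in two directions is the curve created there. *)
Lemma label_branching u W c d t t' : is_label K u -> c != d ->
  germ u (W ++ c :: t) 0%N 0%N = 0 -> germ u (W ++ d :: t') 0%N 0%N = 0 ->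
  u = LabExc W.
Proof.
move=> lu cd u1 u2; have [b1 b2] := (germ_born u1, germ_born u2).
have [bW|bW] := boolP (born u W).
  move: u1 u2; rewrite !germ_cat //= => /strict_vanish u1 /strict_vanish u2.
  have W0 : germ u W 0%N 0%N = 0.
    by apply: (@strict_vanish [:: c]).
  by case/eqP: cd; apply: (smooth_direction_unique (germ_smooth0 lu W0) u1 u2).
have pre (Q : inpt R) :
    infnear Q (W ++ c :: t) -> infnear Q (W ++ d :: t') -> infnear Q W.
  rewrite /infnear; elim: {b1 b2 u1 u2 bW} W Q => [|a W IH] [|q Q] //=.
    by move=> /andP[/eqP -> _] /andP[/eqP E _]; rewrite E eqxx in cd.
  by move=> /andP[/eqP -> H] /andP[_ /(IH _ H) ->]; rewrite eqxx.
case: u {lu u1 u2} b1 b2 bW => [|Q|Q] //= b1 b2; first by rewrite pre.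
have QW : infnear Q W by apply: pre; [case/andP: b1|case/andP: b2].
by rewrite /sinfnear QW /= negbK => /eqP ->.
Qed.

(** If Q is strictly above P, the two branches at P are transversal and cannot both reach Q. If P
    and Q separate at W, every label through both is E_W, whereas a cross has two distinct
    labels. *)
Lemma dual_inj P Q : pts K P -> pts K Q -> dual P = dual Q -> P = Q.
Proof.
have below P1 P2 : pts K P1 -> dual P1 = dual P2 -> infnear P1 P2 -> P1 = P2.
  move=> kP E PQ; apply: contrapT => /eqP ne.
  have [u [v [lu lv uv cuv]]] := cross_labels kP.
  have [du dv] := dual_cross_labels lu lv uv cuv.
  have /local_coordinatesP[_ su _ sv J] := uv.
  rewrite E in du dv; have := germ_vanish du; have := germ_vanish dv.
  have [c [t ->]] : exists c t, P2 = P1 ++ c :: t.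
    by apply/sinfnearP; rewrite /sinfnear PQ.
  rewrite !germ_cat ?germ_born ?su.1 ?sv.1 //= => /strict_vanish v0 /strict_vanish u0.
  exact: transversal_separate su sv J u0 v0.
move=> kP kQ E; have [PQ|PQ] := boolP (infnear P Q); first exact: below.
have [QP|QP] := boolP (infnear Q P); first by apply/esym/below.
have [W [c [d [t [t' [PE QE cd]]]]]] := incomparable PQ QP.
have [u [v [lu lv uv cuv]]] := cross_labels kP.
have /local_coordinatesP[_ _ _ _ J] := uv.
have excW w : is_label K w -> dual P w -> w = LabExc W.
  move=> lw dw; apply: (label_branching lw cd (t := t) (t' := t')).
    by rewrite -PE; apply: germ_vanish.
  by rewrite -QE; apply: germ_vanish; rewrite -E.
have [du dv] := dual_cross_labels lu lv uv cuv.
case/eqP: J; rewrite (excW u) // (excW v) // /jacobian; ring.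
Qed.

(** * Petals of the lotus and weights of the edges *)

Local Notation Lambda := (lotus_of K lineL line s).

Lemma petals_lotus e v : petals Lambda (e, v) <->
  exists P, [/\ active K P, e = dual P & v = LabExc P].
Proof.
have step (T : lotus R) P : petals (lotus_step K lineL line T P) (e, v) <->
    petals T (e, v) \/ [/\ active K P, e = dual P & v = LabExc P].
  rewrite /lotus_step; case: asboolP => aP; case: ifP => _ /=.
  - by split=> [[?|[-> ->]]|[?|[_ -> ->]]]; [left|right|left|right].
  - by split=> [[?|[-> ->]]|[?|[_ -> ->]]]; [left|right|left|right].
  - by split=> [?|[//|[/aP]]] //; left.
  - by split=> [?|[//|[/aP]]] //; left.
have fold (r : seq (inpt R)) (T : lotus R) :
    petals (foldl (lotus_step K lineL line) T r) (e, v) <->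
    petals T (e, v) \/
    exists2 P, P \in r & [/\ active K P, e = dual P & v = LabExc P].
  elim: r T => [|Q r IH] T /=; first by split=> [|[//|[]]] //; left.
  split=> [/IH[/step[?|H]|[P Pr H]]|[H|[P]]].
  - by left.
  - by right; exists Q; rewrite ?mem_head.
  - by right; exists P; rewrite // inE Pr orbT.
  - by apply/IH; left; apply/step; left.
  - rewrite inE => /orP[/eqP ->|Pr] H; apply/IH; last by right; exists P.
    by left; apply/step; right.
split=> [/fold[//|[P _ H]]|[P H]]; first by exists P.
apply/fold; right; exists P => //; have [_ E _] := s_order.
by have [/active_pts] := H; rewrite E.
Qed.

Lemma edge_weight_inv e n : edge_weight K lineL line Lambda e n ->
  (exists Q, [/\ inactive K Q, e = dual Q & n = 1%N]) \/
  exists P (w : set (label R) -> nat), [/\ active K P, e = dual P,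
    forall e', higher K lineL line e e' -> e' (LabExc P) ->
      edge_weight K lineL line Lambda e' (w e') &
    n = (\sum_(e' \in [set e' | higher K lineL line e e' /\ e' (LabExc P)]) w e')%R].
Proof.
case=> [{}e Q _ iQ E|{}e Q _ iQ E|{}e v w /petals_lotus[P [aP E ->]] H].
- by left; exists Q.
- by left; exists Q.
- by right; exists P, w.
Qed.

(** The petal rule cannot apply to this edge, since an edge determines its point; the other two
    rules cover base and lateral edges. *)
Lemma inactive_weight Q n : inactive K Q ->
  edge_weight K lineL line Lambda (dual Q) n <-> n = 1%N.
Proof.
move=> iQ; split=> [/edge_weight_inv[[Q' [_ _ //]]|[P [w [aP E _ _]]]]|->].
  case: (iQ) => kQ; rewrite (dual_inj kQ (active_pts aP) E) => /(_ aP) [].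
have [b|b] := pselect (base_edges Lambda (dual Q)).
  exact: weight_base b iQ erefl.
exact: weight_lateral b iQ erefl.
Qed.

Let mem_s P : P \in s <-> pts K P.
Proof. by have [_ -> _] := s_order. Qed.

(** By [dual_inj] and [exc_in_dual], the edges of the sum correspond bijectively to the points
    proximate to P, so the proximity equality applies. *)
Lemma higher_sum P (w : set (label R) -> nat) : active K P ->
  (forall Q, pts K Q -> sinfnear P Q -> dual Q (LabExc P) ->
     w (dual Q) = multiplicity A Q) ->
  (\sum_(e' \in [set e' | higher K lineL line (dual P) e' /\ e' (LabExc P)]) w e')%R
    = multiplicity A P.
Proof.
move=> aP wE; have kP := active_pts aP; have [s_uniq _ _] := s_order.
have sP Q : Q \in s <-> (forall Q', sinfnear Q' Q -> D Q') /\ strict Q A 0%N 0%N = 0.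
  by rewrite mem_s ptsP.
have sP' := (mem_s P).2 kP.
rewrite -(proximity_equality A_reduced s_uniq sP resolution (active_D aP) sP').
rewrite -big_filter; set r := filter _ _.
have r_uniq : uniq r by apply: filter_uniq.
have rE Q : Q \in r <-> [/\ pts K Q, sinfnear P Q & dual Q (LabExc P)].
  rewrite mem_filter; split=> [/andP[/andP[PQ ex] /mem_s kQ]|[kQ PQ dQ]].
    by split=> //; apply/exc_in_dual.
  by rewrite PQ (exc_in_dual aP kQ PQ).1 // (mem_s Q).2.
rewrite (_ : [set e' | _] = dual @` [set` r]); last first.
  apply/seteqP; split=> e' /=.
    move=> [[P' [Q [kP' kQ PQ E ->]]] dQ]; exists Q => //; apply/rE; split=> //.
    by rewrite (dual_inj kP kP' E).
  move=> [Q /rE[kQ PQ dQ] <-]; split=> //; by exists P, Q.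
rewrite fsbig_image => [|Q Q']; last first.
  by rewrite !inE => /rE[kQ _ _] /rE[kQ' _ _]; apply: dual_inj.
rewrite -fsbig_seq //; apply: eq_big_seq => Q /rE[kQ PQ dQ]; exact: wE.
Qed.

Lemma active_weight P n : active K P ->
  edge_weight K lineL line Lambda (dual P) n <-> n = multiplicity A P.
Proof.
(* N bounds the lengths of the points of the constellation; the induction descends from the longest
   ones. *)
pose N := (\max_(Q <- s) size Q)%N.
have [m] := ubnP (N - size P)%N; elim: m P n => // m IH P n Pm aP.
have weight Q k : pts K Q -> sinfnear P Q ->
    edge_weight K lineL line Lambda (dual Q) k <-> k = multiplicity A Q.
  move=> kQ PQ; have [aQ|naQ] := pselect (active K Q).
    apply: IH => //; have QN : (size Q <= N)%N.
      by apply: leq_bigmax_seq => //; apply/mem_s.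
    case/sinfnearP: PQ => c [t E]; move: QN Pm; rewrite E size_cat /=; lia.
  rewrite inactive_weight // inactive_multiplicity //.
  by case/sinfnearP: PQ => c [t ->]; case: (P).
have kP := active_pts aP; split.
  case/edge_weight_inv => [[Q [[kQ naQ] E _]]|[P' [w [aP' E wP ->]]]].
    by case: naQ; rewrite -(dual_inj kP kQ E).
  have {}E := dual_inj kP (active_pts aP') E; rewrite -E in wP *.
  apply: higher_sum => // Q kQ PQ dQ; apply/(weight Q _ kQ PQ)/wP => //.
  by exists P, Q.
(* For existence, the petal rule needs a weight function on edges: the multiplicity at the
   corresponding point, well defined by [dual_inj], with value 0 on sets that are not dual
   segments. *)
move=> ->; pose w e := xget 0%N
  [set k | exists Q, [/\ pts K Q, e = dual Q & k = multiplicity A Q]].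
have wE Q : pts K Q -> w (dual Q) = multiplicity A Q.
  move=> kQ; apply: xget_unique => [|k [Q' [kQ' E ->]]]; first by exists Q.
  by rewrite (dual_inj kQ kQ' E).
rewrite -(@higher_sum P w aP) => [|Q kQ _ _]; last exact: wE.
apply: weight_petal => [|e' [P' [Q [kP' kQ PQ E ->]]] dQ].
  by apply/petals_lotus; exists P.
by rewrite -(dual_inj kP kP' E) in PQ; apply/weight => //; apply: wE.
Qed.

End Lotus.

Theorem corollary8p6 (R : realType)
  (A : series R) (hA : reduced_curve A)
  (K : crosses R) (hK : active_constellation_of_crosses K)
  (hfin : finite_set (pts K)) (hadapt : adapted K A)
  (lineL : series R) (line : inpt R -> series R)
  (hnames : names_lines K lineL line)
  (s : seq (inpt R)) (hs : compatible_order K s) :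
  let Lambda := lotus_of K lineL line s in
  forall e : set (label R), petal_base Lambda e ->
  forall P : inpt R, active K P -> e = dual_segment K lineL line P ->
  forall n : nat,
    edge_weight K lineL line Lambda e n <-> n = multiplicity A P.
Proof.
have [D hD] := hadapt; move=> Lambda e _ P aP -> n.
exact: (active_weight hA hK hD hnames hs).
Qed.
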